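(* Let $p$ be an odd prime and let $h\ge 1$. 1. Let $R(X)=X^{p^h}$. Then $E(X)=X^{p^{2h}}+X$, which has splitting field $\mathbb{F}_q=\mathbb{F}_{p^{4h}}$. The curve $C_R$ is minimal over $\mathbb{F}_q$. 2. Let $a_h\in\mathbb{F}_{p^{2h}}^*$ be an element with $a_h^{p^h-1}=-1$ and define $R(X)=a_hX^{p^h}$. Then $E(X)=a_h^{p^h}(X^{p^{2h}}-X)$, which has splitting field $\mathbb{F}_q=\mathbb{F}_{p^{2h}}$. The curve $C_R$ is maximal over $\mathbb{F}_q$.
   Context: For an additive polynomial $R(X)=\sum_{i=0}^h a_iX^{p^i}$ with $a_h\ne0$ over a finite field $\mathbb{F}_{p^r}$, $C_R$ denotes the smooth projective absolutely irreducible curve with affine equation $Y^p-Y=XR(X)$, which has genus $p^h(p-1)/2$, and $E(X)=R(X)^{p^h}+\sum_{i=0}^h (a_iX)^{p^{h-i}}$. A curve $C$ of genus $g(C)$ over a finite field $\mathbb{F}_{p^s}$ is called maximal if $\#C(\mathbb{F}_{p^s})=p^s+1+2p^{s/2}g(C)$ and minimal if $\#C(\mathbb{F}_{p^s})=p^s+1-2p^{s/2}g(C)$. *)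

(* Defs.v *)
From HB Require Import structures.
From mathcomp Require Import all_boot all_order all_algebra all_field.
From mathcomp Require Import boolp classical_sets cardinality.

Set Implicit Arguments.
Unset Strict Implicit.
Unset Printing Implicit Defensive.

Import GRing.Theory Num.Theory.

Local Open Scope classical_set_scope.
Local Open Scope card_scope.
Local Open Scope ring_scope.

(* A smooth projective absolutely irreducible curve C over K is represented by
   its function field F = K(C), with iota : K -> F the inclusion of constants:
   the closed points of C are the valuation rings of F/K, and the K-rational
   points are those whose residue field is K. *)
Section FunctionField.

Variables (K F : fieldType) (iota : {rmorphism K -> F}).

(* Valuation rings of F/K.  For z = 0 the last clause is harmless since
   0^-1 = 0. *)
Definition is_place (O : set F) : Prop :=
  [/\ forall c, O (iota c),
      forall u v, O u -> O v -> O (u - v),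
      forall u v, O u -> O v -> O (u * v),
      exists z, ~ O z
    & forall z, O z \/ O z^-1].

(* The non-units of O; z = 0 is singled out because 0^-1 = 0. *)
Definition place_ideal (O : set F) : set F :=
  [set z | O z /\ (z = 0 \/ ~ O z^-1)].

Definition rational_places : set (set F) :=
  [set O | is_place O /\
           forall z, O z -> exists c : K, place_ideal O (z - iota c)].

Record derivation := Derivation {
  der_fun :> F -> F;
  _ : forall u v, der_fun (u + v) = der_fun u + der_fun v;
  _ : forall u v, der_fun (u * v) = u * der_fun v + v * der_fun u;
  _ : forall c, der_fun (iota c) = 0 }.

(* As F/K is finitely generated, the space of Kaehler differentials of F/K is
   finite-dimensional over F, hence is the F-dual of Der_K(F, F): the
   differential sum_i f_i du_i is identified with the functional
   D |-> sum_i f_i D(u_i).  It is regular at the point O when all the f_i and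
   u_i can be chosen in O. *)
Definition regular_at (O : set F) (w : derivation -> F) : Prop :=
  exists s : seq (F * F),
    (forall fu, fu \in s -> O fu.1 /\ O fu.2) /\
    forall D : derivation, w D = \sum_(fu <- s) fu.1 * D fu.2.

Definition regular_differential (w : derivation -> F) : Prop :=
  forall O, is_place O -> regular_at O w.

(* The genus of C is the dimension over K of the space of its everywhere
   regular differentials; w is a basis of that space. *)
Definition has_genus (g : nat) : Prop :=
  exists w : 'I_g -> derivation -> F,
    (forall i, regular_differential (w i)) /\
    forall eta, regular_differential eta ->
      exists! c : {ffun 'I_g -> K},
        forall D, eta D = \sum_(i < g) iota (c i) * w i D.

Definition eval2 (u : {poly {poly K}}) (x y : F) : F :=
  (map_poly (fun f : {poly K} => (map_poly iota f).[x]) u).[y].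

(* F = K(x, y) is the function field of the curve Y^p - Y = X R(X) over K.
   These conditions determine F, x and y up to isomorphism. *)
Definition is_function_field_CR (p : nat) (R : {poly K}) (x y : F) : Prop :=
  [/\ forall f : {poly K}, (map_poly iota f).[x] = 0 -> f = 0,
      y ^+ p - y = x * (map_poly iota R).[x]
    & forall z, exists u v : {poly {poly K}},
        eval2 v x y != 0 /\ z = eval2 u x y / eval2 v x y].

End FunctionField.

Definition maximal_curve (K : finFieldType) (F : fieldType)
    (iota : {rmorphism K -> F}) : Prop :=
  exists N g : nat,
    [/\ rational_places iota #= `I_N, has_genus iota g
      & N%:R = #|K|%:R + 1 + 2 * sqrtC #|K|%:R * g%:R :> algC].

Definition minimal_curve (K : finFieldType) (F : fieldType)
    (iota : {rmorphism K -> F}) : Prop :=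
  exists N g : nat,
    [/\ rational_places iota #= `I_N, has_genus iota g
      & N%:R = #|K|%:R + 1 - 2 * sqrtC #|K|%:R * g%:R :> algC].

Definition maximal_CR (p : nat) (K : finFieldType) (R : {poly K}) : Prop :=
  forall (F : fieldType) (iota : {rmorphism K -> F}) (x y : F),
    is_function_field_CR iota p R x y -> maximal_curve iota.

Definition minimal_CR (p : nat) (K : finFieldType) (R : {poly K}) : Prop :=
  forall (F : fieldType) (iota : {rmorphism K -> F}) (x y : F),
    is_function_field_CR iota p R x y -> minimal_curve iota.

(* For R = sum_(i <= h) a_i X^(p^i), the coefficient a_i is R`_(p ^ i). *)
Definition E_poly (p h : nat) (K : fieldType) (R : {poly K}) : {poly K} :=
  R ^+ (p ^ h) + \sum_(i < h.+1) (R`_(p ^ i) *: 'X) ^+ (p ^ (h - i)).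

(* K is the splitting field of E over every field of definition U of R
   contained in K; pPrimeCharType charK is K viewed as an extension of 'F_p. *)
Definition splitting_field_of (p : nat) (K : finFieldType)
    (charK : p \in [pchar K]) (R E : {poly K}) : Prop :=
  forall U : {subfield pPrimeCharType charK},
    (R : {poly pPrimeCharType charK}) \is a polyOver U ->
    splittingFieldFor U (E : {poly pPrimeCharType charK}) fullv.

(* Main.v *)
(* At a place where x has a pole, x^i y^j with j < p has pole order i p + j (p^h + 1),
   and these orders are distinct.  Hence the x^i y^j are linearly independent, there is
   exactly one infinite place, and it is rational.  At a place O containing x, the ring
   A = K[x, y] is unramified over K[x], so that O is a localization of A; the rational
   ones correspond to the affine points.  A differential f dx is regular at all finite
   places iff f is in A, and it is regular at infinity iff moreover f has pole order at
   most 2g - 2, because t = x^(p^(h-1))/y is a local parameter and dt/dx has order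
   -(2g - 2).  A symmetry of the monomials then gives 2g = p^h (p - 1).
   The number of affine points is p times the number of z with Tr(a z^(p^h + 1)) = 0.
   In the maximal case this trace vanishes identically; in the minimal case it equals
   the trace from F_(p^h) to F_p of u^(p^h + 1) with u = z + z^(p^(2h)). *)
From HB Require Import structures.
Require Import Defs.
From mathcomp Require Import all_boot all_order all_algebra all_field.
From mathcomp Require Import boolp classical_sets functions cardinality.
From mathcomp Require Import ring zify.

Set Implicit Arguments.
Unset Strict Implicit.
Unset Printing Implicit Defensive.

Import Order.TTheory GRing.Theory Num.Theory.
Local Open Scope ring_scope.

(** * Valuation rings *)

(** Places are handled as bare valuation rings, with no valuation at hand. They are produced by
    Zorn's lemma, and orders at infinity are replaced by leading terms [c t^k] that hold at every
    infinite place at once; uniqueness of that place is then a consequence and not a prerequisite.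
    At the finite places Frobenius replaces integral closure and local parameters. Every function
    has a power of some [x^N - x] as denominator, with [N] a power of the order of [K]. Modulo
    [x^N - x] the [N]-th power map fixes the polynomials in [x] and translates [y] by one of them,
    so its [p]-th iterate is the identity on [K[x, y]]. This lets a factor [x^N - x] that vanishes
    at a place be cancelled from the denominator of a function regular there. Regularity allows any
    expression in [f_i du_i] with entries in [O], so it has to be turned into a bound on the poles
    of [f] in [f dx]: [d/dx] preserves each finite place and lowers orders at infinity by a bounded
    amount. *)

Section PlaceTheory.

Variables (K F : fieldType) (iota : {rmorphism K -> F}) (O : set F).
Hypothesis placeO : is_place iota O.

Local Notation m := (place_ideal O).

Lemma place_iota c : O (iota c).
Proof. by case: placeO. Qed.

Lemma placeB u v : O u -> O v -> O (u - v).
Proof. by case: placeO => _ h _ _ _; apply: h. Qed.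

Lemma placeM u v : O u -> O v -> O (u * v).
Proof. by case: placeO => _ _ h _ _; apply: h. Qed.

Lemma place_inv z : ~ O z -> O z^-1.
Proof. by case: placeO => _ _ _ _ h; case: (h z). Qed.

Lemma place0 : O 0.
Proof. by rewrite -(rmorph0 iota); apply: place_iota. Qed.

Lemma place1 : O 1.
Proof. by rewrite -(rmorph1 iota); apply: place_iota. Qed.

Lemma placeN u : O u -> O (- u).
Proof. by move=> Ou; rewrite -sub0r; apply: placeB => //; apply: place0. Qed.

Lemma placeD u v : O u -> O v -> O (u + v).
Proof. by move=> Ou Ov; rewrite -[v]opprK; apply: placeB => //; apply: placeN. Qed.

Lemma placeX u n : O u -> O (u ^+ n).
Proof.
by move=> Ou; elim: n => [|n IH]; [exact: place1 | rewrite exprS; apply: placeM].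
Qed.

Lemma place_sum (I : Type) (r : seq I) (P : pred I) (f : I -> F) :
  (forall i, P i -> O (f i)) -> O (\sum_(i <- r | P i) f i).
Proof. by move=> h; apply: big_ind => //; [exact: place0 | exact: placeD]. Qed.

Lemma place_idealE z : m z <-> z = 0 \/ ~ O z^-1.
Proof.
split; first by case.
case=> [->|h]; first by split; [exact: place0 | left].
by split; [rewrite -[z]invrK; apply: place_inv | right].
Qed.

Lemma place_ideal_sub z : m z -> O z.
Proof. by case. Qed.

Lemma place_ideal0 : m 0.
Proof. by apply/place_idealE; left. Qed.

Lemma place_ideal1 : ~ m 1.
Proof.
case/place_idealE; first by move/eqP; rewrite oner_eq0.
by rewrite invr1; apply; exact: place1.
Qed.

Lemma place_idealV z : ~ O z -> m z^-1.
Proof. by move=> h; apply/place_idealE; right; rewrite invrK. Qed.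

Lemma place_unitV z : O z -> ~ m z -> O z^-1.
Proof. by move=> Oz nz; apply: contrapT => h; apply: nz; split => //; right. Qed.

Lemma place_idealMl w z : O w -> m z -> m (w * z).
Proof.
move=> Ow /place_idealE mz; apply/place_idealE.
have [->|w0] := eqVneq w 0; first by left; rewrite mul0r.
case: mz => [->|h]; first by left; rewrite mulr0.
right; rewrite invfM => h'; apply: h.
by rewrite -[z^-1](mulKf w0) mulrA [_^-1 * _]mulrC -mulrA; apply: placeM => //;
  rewrite mulrC [z^-1 * _]mulrC.
Qed.

Lemma place_idealMr w z : O w -> m z -> m (z * w).
Proof. by rewrite mulrC; apply: place_idealMl. Qed.

(** One of [u / v] and [v / u] lies in [O], so the sum is a multiple of [v] or of [u]. *)
Lemma place_idealD u v : m u -> m v -> m (u + v).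
Proof.
have [->|u0] := eqVneq u 0; first by rewrite add0r.
have [->|v0] := eqVneq v 0; first by rewrite addr0.
move=> mu mv; have [h|h] := pselect (O (u / v)).
  rewrite (_ : u + v = (u / v + 1) * v); last by rewrite mulrDl divfK // mul1r.
  by apply: place_idealMl => //; apply: placeD => //; exact: place1.
rewrite (_ : u + v = (1 + v / u) * u); last by rewrite mulrDl divfK // mul1r.
apply: place_idealMl => //; apply: placeD; first exact: place1.
by rewrite -[v / u]invrK invf_div; apply: place_inv.
Qed.

Lemma place_idealN u : m u -> m (- u).
Proof.
by move=> mu; rewrite -mulN1r; apply: place_idealMl => //; apply/placeN/place1.
Qed.

Lemma place_idealB u v : m u -> m v -> m (u - v).
Proof. by move=> mu mv; apply: place_idealD => //; apply: place_idealN. Qed.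

Lemma place_ideal_sum (I : Type) (r : seq I) (P : pred I) (f : I -> F) :
  (forall i, P i -> m (f i)) -> m (\sum_(i <- r | P i) f i).
Proof.
by move=> h; apply: big_ind => //; [exact: place_ideal0 | exact: place_idealD].
Qed.

Lemma place_ideal_iota c : m (iota c) -> c = 0.
Proof.
move=> mc; apply/eqP; apply: contrapT => /negP c0; apply: place_ideal1.
rewrite -(mulVf (_ : iota c != 0)) ?fmorph_eq0 // -fmorphV.
by apply: place_idealMl => //; apply: place_iota.
Qed.

Lemma place_ideal_prime z w : O z -> m (z * w) -> m z \/ m w.
Proof.
move=> Oz mzw; have [mz|mz] := pselect (m z); [by left | right].
have z0 : z != 0 by apply/eqP => z0; apply: mz; rewrite z0; exact: place_ideal0.
by rewrite -[w](mulKf z0); apply: place_idealMl => //; apply: place_unitV.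
Qed.

Lemma place_idealX z n : O z -> m (z ^+ n) -> m z.
Proof.
move=> Oz; elim: n => [/place_ideal1//|n IH].
by rewrite exprS => /(place_ideal_prime Oz) [].
Qed.

Lemma place_ideal_expS z n : m z -> m (z ^+ n.+1).
Proof.
by move=> mz; rewrite exprSr; apply: place_idealMl => //; apply/placeX/place_ideal_sub.
Qed.

Lemma place_root z n : (0 < n)%N -> O (z ^+ n) -> O z.
Proof.
case: n => // n _ On; apply: contrapT => nz.
have mz := place_idealV nz; apply: place_ideal1.
have z0 : z != 0 by apply/eqP => z0; apply: nz; rewrite z0; exact: place0.
rewrite -(mulVf (expf_neq0 n.+1 z0)) -exprVn; apply: place_idealMr => //.
exact: place_ideal_expS.
Qed.

(** * One-units of a place, the error factors of leading terms *)

Lemma one_unit_place z : m (z - 1) -> O z.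
Proof.
by move=> /place_ideal_sub h; rewrite -(subrK 1 z); apply: placeD => //; exact: place1.
Qed.

Lemma one_unit_notin z : m (z - 1) -> ~ m z.
Proof.
move=> h hz; apply: place_ideal1; rewrite (_ : 1 = z - (z - 1)); last by ring.
exact: place_idealB.
Qed.

Lemma one_unit_neq0 z : m (z - 1) -> z != 0.
Proof.
by move=> h; apply/eqP => z0; apply: (one_unit_notin h); rewrite z0; exact: place_ideal0.
Qed.

Lemma one_unitM z w : m (z - 1) -> m (w - 1) -> m (z * w - 1).
Proof.
move=> mz mw; rewrite (_ : _ - 1 = w * (z - 1) + (w - 1)); last by ring.
by apply: place_idealD => //; apply: place_idealMl => //; exact: one_unit_place.
Qed.

Lemma one_unitV z : m (z - 1) -> m (z^-1 - 1).
Proof.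
move=> mz; have z0 := one_unit_neq0 mz.
rewrite (_ : _ - 1 = - z^-1 * (z - 1)); last by field.
apply: place_idealMl => //; apply: placeN.
by apply: place_unitV; [exact: one_unit_place | exact: one_unit_notin].
Qed.

Lemma one_unitX z n : m (z - 1) -> m (z ^+ n - 1).
Proof.
move=> mz; elim: n => [|n IH]; first by rewrite expr0 subrr; exact: place_ideal0.
by rewrite exprS; apply: one_unitM.
Qed.

End PlaceTheory.

(** * Existence of places above a given subring *)

Section PlaceExists.

Variables (K F : fieldType) (iota : {rmorphism K -> F}).

Definition is_subring (S : set F) :=
  [/\ forall c, S (iota c), forall u v, S u -> S v -> S (u - v)
    & forall u v, S u -> S v -> S (u * v)].

Section Degree.

Variables (S : set F) (t : F).
Hypotheses (subS : is_subring S) (St : S t) (StV : ~ S t^-1).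
Hypothesis maxS : forall S' : set F,
  is_subring S' -> (S `<=` S')%classic -> ~ S' t^-1 -> S' = S.

Let S_0 : S 0. Proof. by rewrite -(rmorph0 iota); case: subS. Qed.
Let S_1 : S 1. Proof. by rewrite -(rmorph1 iota); case: subS. Qed.
Let S_B u v : S u -> S v -> S (u - v). Proof. by case: subS => _ h _; apply: h. Qed.
Let S_M u v : S u -> S v -> S (u * v). Proof. by case: subS => _ _ h; apply: h. Qed.
Let S_N u : S u -> S (- u).
Proof. by move=> Su; rewrite -sub0r; apply: S_B. Qed.
Let S_D u v : S u -> S v -> S (u + v).
Proof. by move=> Su Sv; rewrite -[v]opprK; apply: S_B => //; apply: S_N. Qed.
Let S_X u n : S u -> S (u ^+ n).
Proof. by move=> Su; elim: n => [|n IH] //; rewrite exprS; apply: S_M. Qed.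
Let S_sum (I : Type) (r : seq I) (P : pred I) (f : I -> F) :
  (forall i, P i -> S (f i)) -> S (\sum_(i <- r | P i) f i).
Proof. by move=> h; apply: big_ind. Qed.

Let t0 : t != 0.
Proof. by apply/eqP => t0; apply: StV; rewrite t0 invr0. Qed.

(* Otherwise, by maximality, 1/t lies in S[1/(1 - tb)], whence (1 - tb)^n is in tS. *)
Lemma maximal_subring_unit b : S b -> S (1 - t * b)^-1.
Proof.
move=> Sb; set e := 1 - t * b.
have Se : S e by apply: S_B => //; apply: S_M.
pose S' : set F := [set z | exists n s, S s /\ z = s * e^-1 ^+ n]%classic.
have [e0|e0] := eqVneq e 0; first by rewrite e0 invr0.
have eX n : e ^+ n != 0 by apply: expf_neq0.
have subS' : is_subring S'.
  split=> [c|u v [n [s [Ss ->]]] [k [r [Sr ->]]]|u v [n [s [Ss ->]]] [k [r [Sr ->]]]].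
  - by exists 0%N, (iota c); rewrite expr0 mulr1; split=> //; case: subS.
  - exists (n + k)%N, (s * e ^+ k - r * e ^+ n); split.
      by apply: S_B; apply: S_M => //; apply: S_X.
    rewrite !exprVn exprD; field; rewrite !eX //.
  - exists (n + k)%N, (s * r); split; first exact: S_M.
    by rewrite exprD mulrACA.
have SS' : (S `<=` S')%classic.
  by move=> z Sz; exists 0%N, z; rewrite expr0 mulr1.
have [|h] := pselect (S' t^-1); last first.
  rewrite -(maxS subS' SS' h); exists 1%N, 1; split=> //.
  by rewrite mul1r expr1.
case=> n [s [Ss tE]]; exfalso.
have eE : e ^+ n = t * s.
  have: t^-1 * e ^+ n * t = s * e^-1 ^+ n * e ^+ n * t by rewrite tE.
  by rewrite mulrAC mulVf // mul1r -mulrA exprVn -mulrA mulKf // mulrC.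
have [r Sr erE] : exists2 r, S r & e ^+ n = 1 - t * r.
  elim: n {eE tE} => [|n [r Sr rE]]; first by exists 0 => //; rewrite mulr0 subr0.
  exists (r + b - t * (r * b)).
    by apply: S_B; [apply: S_D | apply: S_M => //; apply: S_M].
  by rewrite exprS rE /e; ring.
apply: StV; have -> : t^-1 = r + s.
  apply: (mulfI t0); rewrite mulfV // mulrDr -eE erE; ring.
exact: S_D.
Qed.

Let tS (P : {poly F}) := forall i, exists2 s, S s & P`_i = t * s.

(** The constant term of [Q] lies in [tS], so [1 - Q_0] is a unit of [S] and [Q(1/z) = 1],
    multiplied by [z^(n+1)], expresses [z^(n+1)] through lower powers with coefficients in [tS].
    Substituting this for the leading power in [P(z) = 1] lowers the degree; [k <= n + 1] keeps the
    exponents non-negative. *)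
Lemma maximal_subring_descent z n k (P Q : {poly F}) :
    (size P <= n.+2)%N -> (size Q <= k.+1)%N -> (k <= n.+1)%N ->
    tS P -> tS Q -> P.[z] = 1 -> Q.[z^-1] = 1 -> z != 0 ->
  exists2 P' : {poly F}, (size P' <= n.+1)%N & tS P' /\ P'.[z] = 1.
Proof.
move=> sP sQ kn tP tQ Pz Qz z0.
have [b Sb bE] := tQ 0%N.
have Su := maximal_subring_unit Sb; set e := 1 - t * b in Su *.
have [e0|e0] := eqVneq e 0.
  exfalso; apply: StV; have -> : t^-1 = b; last by [].
  apply: (mulfI t0); rewrite mulfV //; apply/eqP; rewrite -subr_eq0 -/e.
  by apply/eqP.
pose c := P`_n.+1 / e.
exists (\poly_(i < n.+1) (P`_i + c * (if (n.+1 - i <= k)%N then Q`_(n.+1 - i) else 0))).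
  exact: size_poly.
split.
  move=> i; rewrite coef_poly; case: ltnP => _; last by exists 0; rewrite ?mulr0.
  have [s Ss ->] := tP i; have [r Sr rE] := tP n.+1.
  rewrite /c rE; case: ifP => _; last by exists s => //; rewrite mulr0 addr0.
  have [q Sq ->] := tQ (n.+1 - i)%N.
  exists (s + (t * r * e^-1) * q); last by ring.
  by apply: S_D => //; apply: S_M => //; apply: S_M => //; apply: S_M.
have QE : z ^+ n.+1 * e = \sum_(i < n.+1)
     (if (n.+1 - i <= k)%N then Q`_(n.+1 - i) else 0) * z ^+ i.
  have : z ^+ n.+1 * Q.[z^-1] = z ^+ n.+1 by rewrite Qz mulr1.
  rewrite (horner_coef_wide _ (leq_trans sQ (_ : (k.+1 <= n.+2)%N))) //.
  rewrite big_ord_recl expr0 mulr1 mulrDr bE => h.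
  rewrite /e mulrBr mulr1 -[X in X - _]h addrC addKr mulr_sumr.
  rewrite (reindex_inj rev_ord_inj) /=; apply: eq_bigr => i _.
  have -> : bump 0 (n.+1 - i.+1) = (n.+1 - i)%N by rewrite /bump add1n subnSK // .
  have -> : (if (n.+1 - i <= k)%N then Q`_(n.+1 - i) else 0) = Q`_(n.+1 - i).
    by case: leqP => // h'; rewrite nth_default // (leq_trans sQ).
  have -> : z ^+ n.+1 = z ^+ (n.+1 - i) * z ^+ i by rewrite -exprD subnK // ltnW.
  by rewrite exprVn; field; rewrite ?expf_neq0 ?z0.
rewrite horner_poly -Pz (horner_coef_wide _ sP) [RHS]big_ord_recr /=.
under eq_bigr do rewrite mulrDl -mulrA; rewrite big_split /= -mulr_sumr -QE.
by congr (_ + _); rewrite /c; field.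
Qed.

(** Otherwise maximality puts [1/t] in both [S[z]] and [S[1/z]], so that 1 is a polynomial in [z],
    and one in [1/z], with coefficients in [tS]. Descent on the degrees ends with a constant
    polynomial, that is with 1 in [tS], against the choice of [S]. *)
Lemma maximal_subring_valuation z : S z \/ S z^-1.
Proof.
apply: contrapT => /not_orP [nz nzV].
have z0 : z != 0 by apply/eqP => z0; apply: nz; rewrite z0.
have adjoin w : ~ S w -> exists2 P : {poly F}, tS P & P.[w] = 1.
  move=> nw.
  pose S' : set F := [set v | exists2 P : {poly F}, (forall i, S P`_i) & P.[w] = v]%classic.
  have subS' : is_subring S'.
    split=> [c|u v [P SP <-] [Q SQ <-]|u v [P SP <-] [Q SQ <-]].
    - exists (iota c)%:P; rewrite ?hornerC // => i; rewrite coefC.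
      by case: eqP => // _; case: subS.
    - by exists (P - Q); rewrite ?hornerE // => i; rewrite coefB; apply: S_B.
    - exists (P * Q); rewrite ?hornerE // => i; rewrite coefM.
      by apply: S_sum => j _; apply: S_M.
  have SS' : (S `<=` S')%classic.
    by move=> v Sv; exists v%:P; rewrite ?hornerC // => i; rewrite coefC; case: eqP.
  have [[P SP Pw]|h] := pselect (S' t^-1).
    exists (t *: P); last by rewrite hornerZ Pw mulfV.
    by move=> i; exists P`_i => //; rewrite coefZ.
  exfalso; apply: nw; rewrite -(maxS subS' SS' h); exists 'X; rewrite ?hornerX //.
  by move=> i; rewrite coefX; case: eqP.
have main : forall N w n k (P Q : {poly F}), (n + k <= N)%N -> w != 0 ->
    (size P <= n.+1)%N -> (size Q <= k.+1)%N -> tS P -> tS Q ->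
    P.[w] = 1 -> Q.[w^-1] = 1 -> False.
  elim=> [|N IH] w n k P Q.
    rewrite leqn0 addn_eq0 => /andP[/eqP-> _] w0 sP _ tP _ + _.
    rewrite (size1_polyC sP) hornerC; have [s Ss ->] := tP 0%N => ts.
    by apply: StV; rewrite -[t^-1]mulr1 -ts mulKf.
  move=> nkN w0 sP sQ tP tQ Pw Qw.
  have [kn|nk] := leqP k n.
    case: n => [|n] in nkN sP kn *.
      move: Pw; rewrite (size1_polyC sP) hornerC; have [s Ss ->] := tP 0%N => ts.
      by apply: StV; rewrite -[t^-1]mulr1 -ts mulKf.
    have [P' sP' [tP' P'w]] := maximal_subring_descent sP sQ kn tP tQ Pw Qw w0.
    by apply: (IH w n k P' Q).
  case: k => // k in nkN sQ nk *.
  have wV0 : w^-1 != 0 by rewrite invr_eq0.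
  have Pw' : P.[w^-1^-1] = 1 by rewrite invrK.
  have [Q' sQ' [tQ' Q'w]] := maximal_subring_descent sQ sP (ltnW nk) tQ tP Qw Pw' wV0.
  by apply: (IH w n k P Q') => //; rewrite -ltnS -addnS.
have [P tP Pz] := adjoin _ nz; have [Q tQ Qz] := adjoin _ nzV.
by apply: (main _ z (size P) (size Q) P Q (leqnn _)).
Qed.

End Degree.

(* Chevalley's extension theorem for the ideal generated by one element. *)
Lemma place_exists (B : set F) (t : F) :
    is_subring B -> B t -> ~ B t^-1 ->
  exists O, [/\ is_place iota O, (B `<=` O)%classic & place_ideal O t].
Proof.
move=> subB Bt BtV.
pose P : set (set F) := [set S | S = set0 \/
   [/\ is_subring S, (B `<=` S)%classic & ~ S t^-1]]%classic.
have [|S [PS maxS]] := @Zorn_bigcup F P.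
  move=> C CP totC.
  have [[S0 CS0 S0n]|none] := pselect (exists2 S, C S & S <> set0); last first.
    left; apply/seteqP; split => // z [S CS Sz]; apply: none; exists S => // SE.
    by rewrite SE in Sz.
  have CPn S z : C S -> S z -> [/\ is_subring S, (B `<=` S)%classic & ~ S t^-1].
    by move=> CS Sz; case: (CP _ CS) => // SE; rewrite SE in Sz.
  have join u v : (\bigcup_(X in C) X)%classic u -> (\bigcup_(X in C) X)%classic v ->
      exists S, [/\ C S, S u & S v].
    case=> S CS Su [T CT Tv]; case: (totC S T CS CT) => h.
      by exists T; split=> //; apply: h.
    by exists S; split=> //; apply: h.
  right; split.
  - split=> [c|u v Cu Cv|u v Cu Cv].
    + exists S0 => //; case: (CP _ CS0) => // -[[h _ _] _ _]; exact: h.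
    + have [S [CS Su Sv]] := join _ _ Cu Cv; exists S => //.
      by have [[_ h _] _ _] := CPn _ _ CS Su; apply: h.
    + have [S [CS Su Sv]] := join _ _ Cu Cv; exists S => //.
      by have [[_ _ h] _ _] := CPn _ _ CS Su; apply: h.
  - by move=> z Bz; exists S0 => //; case: (CP _ CS0) => // -[_ h _]; apply: h.
  - by case=> S CS St; have [_ _] := CPn _ _ CS St.
have PB : P B by right; split.
have {PS} [subS BS StV] : [/\ is_subring S, (B `<=` S)%classic & ~ S t^-1].
  case: PS => // S0; exfalso; apply: (maxS B) PB; rewrite S0.
  by split=> // h; exact: (h t Bt).
have St : S t by apply: BS.
have maxS' (S' : set F) : is_subring S' -> (S `<=` S')%classic -> ~ S' t^-1 -> S' = S.
  move=> subS' SS' nS'; apply/seteqP; split=> //; apply: contrapT => h.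
  apply: (maxS S'); first by split.
  by right; split=> // z /BS; apply: SS'.
exists S; split=> //.
  case: (subS) => h1 h2 h3; split=> //; first by exists t^-1.
  exact: (maximal_subring_valuation subS St StV maxS').
by split=> //; right.
Qed.

End PlaceExists.

(** * Counting over finite fields *)

(* i p + j (p^h + 1) is the pole order of x^i y^j at infinity, to be compared with
   2g - 2 = p p^h - (p^h + 1) - 1. *)
Definition genus_index p h :=
  [set ij : 'I_(p ^ h) * 'I_p.-1 | (ij.1 * p + ij.2 * (p ^ h).+1 < p * p ^ h - (p ^ h).+1)%N].

Definition affine_points p h (K : finFieldType) (a : K) :=
  [set ab : K * K | ab.2 ^+ p - ab.2 == a * ab.1 ^+ (p ^ h).+1].


(* (i, j) |-> (p^h - 1 - i, p - 2 - j) maps the weight w to 2T - w, and the weight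
   T = p p^h - p^h - 1 is not attained. *)
Lemma card_genus_index p h : prime p -> (0 < h)%N ->
  (#|genus_index p h| * 2 = p ^ h * p.-1)%N.
Proof.
move=> p_pr h0; have p2 := prime_gt1 p_pr.
have [q hE] : exists q, (p ^ h = p * q)%N by exists (p ^ h.-1)%N; rewrite -expnS prednK.
have q0 : (0 < q)%N by have := expn_gt0 p h; rewrite hE (ltnW p2) muln_gt0 => /andP[].
rewrite /genus_index; set P := (p ^ h)%N in hE *; set T := (p * P - P.+1)%N.
have TE : (T = (P - q - 1) * p + p.-1)%N by rewrite /T hE; nia.
pose f (ij : 'I_P * 'I_p.-1) := (rev_ord ij.1, rev_ord ij.2).
have fK : involutive f by case=> i j; rewrite /f /= !rev_ordK.
set S := [set _ | _].
have preS : f @^-1: S = ~: S.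
  apply/setP => -[i j]; rewrite !inE /= -leqNgt.
  have := ltn_ord i; have := ltn_ord j => jp iP.
  (* Modulo [p] the weight is [j < p - 1], whereas [T] is [p - 1]. *)
  have neq : (i * p + j * P.+1)%N != T.
    apply/eqP => e; have : (i * p + j * P.+1 = (i + j * q) * p + j)%N by nia.
    rewrite e TE => /(congr1 (modn^~ p)); rewrite !modnMDl !modn_small; lia.
  have wE : ((P - i.+1) * p + (p.-1 - j.+1) * P.+1 + (i * p + j * P.+1) = T + T)%N.
    rewrite addnACA -!mulnDl (_ : P - i.+1 + i = P.-1)%N; last by lia.
    rewrite (_ : p.-1 - j.+1 + j = p.-2)%N; last by lia.
    rewrite /T; have P0 := leq_ltn_trans (leq0n i) iP; clear -p2 P0.
    by move: (P) P0 => [|l] // _; case: (p) p2 => [|[|k]] //= _; nia.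
  by move: neq wE; move: (_ + _)%N (_ + _)%N => w w'; lia.
have := cardsC S; rewrite -preS card_preimset; last exact: inv_inj.
by rewrite card_prod !card_ord => <-; rewrite muln2 addnn.
Qed.

Lemma card_fibers (T U : finType) (f : T -> U) (S : {set U}) d :
  (forall s, s \in S -> #|[set z | f z == s]| = d) -> #|f @^-1: S| = (#|S| * d)%N.
Proof.
move=> fd; rewrite -sum1_card (partition_big f (mem S)) /=; last by move=> z; rewrite inE.
rewrite -sum_nat_const; apply: eq_bigr => s sS; rewrite -(fd s sS) -sum1_card.
by apply: eq_bigl => z; rewrite !inE andb_idl // => /eqP ->.
Qed.

(** * Root counts over a finite field *)

Section FiniteField.

Variable K : finFieldType.

Lemma dvdp_genPoly (D : {poly K}) : D %| 'X^#|K| - 'X ->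
  exists2 rs : seq K, uniq rs & D %= \prod_(z <- rs) ('X - z%:P).
Proof.
rewrite finField_genPoly => /dvdp_prod_XsubC [s Ds].
by exists (mask s (index_enum K)) => //; rewrite mask_uniq // index_enum_uniq.
Qed.

(** Such a divisor splits with simple roots. The counts below all consist in exhibiting one of known
    degree. *)
Lemma card_roots_dvdp (D : {poly K}) : D %| 'X^#|K| - 'X ->
  #|[set z | root D z]| = (size D).-1.
Proof.
move=> /dvdp_genPoly [rs urs Drs]; rewrite (eqp_size Drs) size_prod_XsubC /=.
rewrite -(card_uniqP urs); apply: eq_card => z.
by rewrite inE (eqp_root Drs) root_prod_XsubC.
Qed.

End FiniteField.

Lemma dvdp_expr_self (K : fieldType) (u : {poly K}) n : (0 < n)%N -> u %| u ^+ n.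
Proof. by case: n => // n _; rewrite exprS dvdp_mulr. Qed.

(** * Additive traces and Artin-Schreier equations *)

Section PowerSum.

Variables (p : nat).
Hypothesis p_prime : prime p.

Lemma exprDp (R : comNzRingType) (charR : p \in [pchar R]) (u v : R) n :
  (u + v) ^+ (p ^ n) = u ^+ (p ^ n) + v ^+ (p ^ n).
Proof.
apply: exprDn_pchar; rewrite pnatX; apply/orP; left.
by rewrite (eq_pnat _ (pcharf_eq charR)) pnat_id.
Qed.

Lemma exprBp (R : comNzRingType) (charR : p \in [pchar R]) (u v : R) n :
  (u - v) ^+ (p ^ n) = u ^+ (p ^ n) - v ^+ (p ^ n).
Proof. by apply/eqP; rewrite eq_sym subr_eq -exprDp // subrK. Qed.

(* On a field with p^n elements this is the absolute trace. *)
Definition ptrace (R : comNzRingType) n (u : R) := \sum_(i < n) u ^+ (p ^ i).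

Lemma ptraceB (R : comNzRingType) (charR : p \in [pchar R]) n (u v : R) :
  ptrace n (u - v) = ptrace n u - ptrace n v.
Proof. by rewrite /ptrace -sumrB; apply: eq_bigr => i _; rewrite exprBp. Qed.

Lemma ptrace_AS (R : comNzRingType) (charR : p \in [pchar R]) n (u : R) :
  ptrace n (u ^+ p - u) = u ^+ (p ^ n) - u.
Proof.
rewrite ptraceB // /ptrace; elim: n => [|n IH].
  by rewrite !big_ord0 expn0 expr1 !subrr.
rewrite !big_ord_recr /= opprD addrACA IH -exprM -expnS.
by rewrite addrC addrA subrK.
Qed.

Lemma ptrace_exprp (R : comNzRingType) (charR : p \in [pchar R]) n (u : R) :
  ptrace n u ^+ p - ptrace n u = u ^+ (p ^ n) - u.
Proof.
elim: n => [|n IH].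
  by rewrite /ptrace !big_ord0 expr0n gtn_eqF ?prime_gt0 // expn0 expr1 !subrr.
rewrite /ptrace !big_ord_recr /= -/(ptrace n u).
rewrite -[in X in (_ + _) ^+ X](expn1 p) exprDp // expn1.
by rewrite opprD addrACA IH -exprM -expnSr addrC addrA subrK.
Qed.

Lemma dvdp_ptrace (K : fieldType) n (u : {poly K}) : u %| ptrace n u.
Proof.
apply: (big_ind (fun v => u %| v)); [exact: dvdp0 | exact: dvdp_add | move=> i _].
by apply: dvdp_expr_self; rewrite expn_gt0 prime_gt0.
Qed.

Variables (K : finFieldType) (r : nat).
Hypotheses (charK : p \in [pchar K]) (cardK : #|K| = (p ^ r)%N).

Let charPK : p \in [pchar {poly K}]. Proof. by rewrite pchar_poly. Qed.

(** A solution forces the trace of [c] to vanish. Conversely [D = X^p - X - c] divides [ptrace r D],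
    which equals [X^q - X - Tr(c)] with [q] the order of [K]; if [Tr(c) = 0], then [D] has [p] roots
    in [K]. *)
Lemma card_artin_schreier (c : K) :
  #|[set b : K | b ^+ p - b == c]| = if ptrace r c == 0 then p else 0%N.
Proof.
case: eqP => [Tc|Tc]; last first.
  apply/eqP; rewrite cards_eq0; apply/eqP/setP => b; rewrite !inE; apply/negP => /eqP bc.
  by apply: Tc; rewrite -bc ptrace_AS // -cardK expf_card subrr.
pose D : {poly K} := 'X^p - 'X - c%:P.
have D_dvd : D %| 'X^#|K| - 'X.
  have := dvdp_ptrace r D; rewrite /D ptraceB // ptrace_AS // -cardK.
  rewrite /ptrace; under eq_bigr do rewrite -rmorphXn /=.
  by rewrite -rmorph_sum /= -/(ptrace r c) Tc subr0.
have -> : [set b : K | b ^+ p - b == c] = [set b | root D b].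
  by apply/setP => b; rewrite !inE /root !hornerE subr_eq0.
rewrite card_roots_dvdp // /D -addrA -opprD size_polyDl ?size_polyXn //.
rewrite size_polyN ltnS (leq_trans (size_polyD _ _)) // geq_max size_polyX prime_gt1 //.
by rewrite (leq_trans (size_polyC_leq1 _)) // prime_gt0.
Qed.

Lemma card_affine_points h (a : K) :
  #|affine_points p h a| = (#|[set al : K | ptrace r (a * al ^+ (p ^ h).+1) == 0]%R| * p)%N.
Proof.
rewrite -sum_nat_const -sum1_card (partition_big fst predT) //=.
rewrite [RHS]big_mkcond /=; apply: eq_bigr => al _; rewrite inE.
rewrite -card_artin_schreier -sum1_card.
rewrite (reindex_onto (fun b => (al, b)) snd) /=; last first.
  by move=> [al' b] /andP[_ /eqP /= ->].
by apply: eq_bigl => b; rewrite !inE /= !eqxx !andbT.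
Qed.

End PowerSum.

(** The element [c = a al^(p^h + 1)] satisfies [c^(p^h) = - c], since [al^(p^(2h)) = al]. The
    conjugates of index [i] and [h + i] cancel in the trace, so every [al] carries [p] points. *)
Lemma card_affine_points_max p h (K : finFieldType) (a : K) :
    prime p -> p \in [pchar K] -> #|K| = (p ^ (2 * h))%N -> a ^+ (p ^ h) = - a ->
  #|affine_points p h a| = (p ^ (2 * h) * p)%N.
Proof.
move=> p_pr charK cardK aP; rewrite (card_affine_points p_pr charK cardK) -cardK.
congr (_ * _)%N; rewrite -cardsT; apply: eq_card => al; rewrite !inE.
have c_pow i : (a * al ^+ (p ^ h).+1) ^+ (p ^ (h + i)) = - (a * al ^+ (p ^ h).+1) ^+ (p ^ i).
  have cP : (a * al ^+ (p ^ h).+1) ^+ (p ^ h) = - (a * al ^+ (p ^ h).+1).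
    rewrite exprMn aP -exprM mulSn exprD -expnD addnn -mul2n -cardK expf_card.
    by rewrite -exprSr mulNr.
  rewrite expnD exprM cP -[- _]sub0r (exprBp p_pr charK) expr0n.
  by rewrite gtn_eqF ?expn_gt0 ?prime_gt0 // sub0r.
apply/eqP; rewrite /ptrace mul2n -addnn big_split_ord /=.
by rewrite -big_split /= big1 // => i _; rewrite c_pow subrr.
Qed.

(** * Affine points in the minimal case *)

Section Minimal.

Variables (p h : nat) (K : finFieldType).
Hypotheses (p_prime : prime p) (h_gt0 : (0 < h)%N).
Hypotheses (charK : p \in [pchar K]) (cardK : #|K| = (p ^ (4 * h))%N).

Local Notation P := (p ^ h)%N.
Local Notation Q := (p ^ (2 * h))%N.

Let charPK : p \in [pchar {poly K}]. Proof. by rewrite pchar_poly. Qed.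
Let PP : (P * P = Q)%N. Proof. by rewrite -expnD addnn mul2n. Qed.
Let QQ : (Q * Q = #|K|)%N. Proof. by rewrite cardK -expnD; congr (_ ^ _)%N; lia. Qed.
Let P_gt1 : (1 < P)%N.
Proof. by rewrite -(expn0 p) ltn_exp2l // prime_gt1. Qed.
Let Q_gt1 : (1 < Q)%N.
Proof. by rewrite -PP; apply: (leq_trans P_gt1); apply: leq_pmulr; apply: ltnW. Qed.

(* The conjugates z_k = z^(P^k), k < 4, satisfy
   z0 z1 + z1 z2 + z2 z3 + z3 z0 = (z0 + z2) (z1 + z3). *)
Lemma ptrace_4h (z : K) :
  ptrace p (4 * h) (z ^+ P.+1) = ptrace p h ((z + z ^+ Q) ^+ P.+1).
Proof.
have -> : z ^+ Q = z ^+ P ^+ P by rewrite -PP exprM.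
have -> : (4 * h = h + (h + (h + h)))%N by lia.
rewrite /ptrace !big_split_ord /= -!big_split /=; apply: eq_bigr => i _.
have pE k : (p ^ (h + k) = P * p ^ k)%N by rewrite expnD.
rewrite !pE !(mulnA P) ![in LHS]exprM -!(exprDp p_prime charK); congr (_ ^+ _).
have zK : (z ^+ P ^+ P ^+ P) ^+ P = z by rewrite -!exprM -[RHS]expf_card -QQ -PP !mulnA.
rewrite ![_ ^+ P.+1]exprS !(exprDp p_prime charK _ _ h, exprMn) zK; ring.
Qed.

Lemma dvdp_genPoly_ph n : ('X^P - 'X : {poly K}) %| 'X^(P ^ n) - 'X.
Proof.
elim: n => [|n IH]; first by rewrite expn0 expr1 subrr dvdp0.
rewrite (_ : 'X^(P ^ n.+1) - 'X = ('X^(P ^ n) - 'X) ^+ P + ('X^P - 'X)); last first.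
  by rewrite (exprBp p_prime charPK) -exprM -expnSr addrA subrK.
by apply: dvdp_add => //; apply: (dvdp_trans IH); apply/dvdp_expr_self/ltnW.
Qed.

Lemma ptrace_root_fixed n : ptrace p h n = 0 -> n ^+ P = n :> K.
Proof.
move=> n0; apply/eqP; rewrite -subr_eq0 -(ptrace_exprp p_prime charK) n0.
by rewrite expr0n gtn_eqF ?prime_gt0 // subrr.
Qed.

(** The trace polynomial [D] has degree [p^(h-1)] and divides [D^p - D = X^P - X], which divides
    [X^q - X]. *)
Lemma card_ptrace_roots : #|[set n : K | ptrace p h n == 0]| = (p ^ h.-1)%N.
Proof.
pose D : {poly K} := ptrace p h 'X.
have -> : [set n : K | ptrace p h n == 0] = [set n | root D n].
  apply/setP => n; rewrite !inE /root /D /ptrace horner_sum.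
  by under [in RHS]eq_bigr do rewrite hornerXn.
rewrite card_roots_dvdp; last first.
  apply: (@dvdp_trans _ ('X^P - 'X)); last first.
    by rewrite cardK (_ : (p ^ (4 * h) = P ^ 4)%N) ?dvdp_genPoly_ph // -expnM mulnC.
  rewrite -(ptrace_exprp p_prime charPK) -/D -(prednK (prime_gt0 p_prime)) exprS.
  by rewrite -[X in _ - X]mulr1 -mulrBr dvdp_mulr.
rewrite /D /ptrace -[in \sum_(_ < h) _](prednK h_gt0) big_ord_recr /= addrC.
rewrite size_polyDl size_polyXn //= ltnS.
apply: (leq_trans (size_sum _ _ _)); apply/bigmax_leqP => i _.
by rewrite size_polyXn ltn_exp2l // prime_gt1.
Qed.

(** On [F_Q] the map [u |-> u^(P+1)] is the norm to [F_P]. From [n^(P-1) = 1], the polynomial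
    [X^(P+1) - n] divides [X^((P+1)(P-1)) - 1]. *)
Lemma card_pow_fiber (n : K) : n != 0 -> n ^+ P = n -> #|[set u : K | u ^+ P.+1 == n]| = P.+1.
Proof.
move=> n0 nP; pose D : {poly K} := 'X^(P.+1) - n%:P.
have -> : [set u : K | u ^+ P.+1 == n] = [set u | root D u].
  by apply/setP => u; rewrite !inE /root /D !hornerE subr_eq0.
rewrite card_roots_dvdp; last first.
  have nP1 : n ^+ P.-1 = 1.
    by apply: (mulfI n0); rewrite mulr1 -exprS prednK // ltnW.
  (* This is [Q^2 - 1 = (P + 1) (P - 1) (Q + 1)], from [Q = P^2]. *)
  have kE : #|K| = (P.+1 * (P.-1 * Q.+1)).+1.
    have := PP; have := QQ; have := P_gt1; have := Q_gt1; nia.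
  rewrite kE exprS -[X in _ - X]mulr1 -mulrBr dvdp_mull // !exprM.
  have sub1 (A : {poly K}) k : A - 1 %| A ^+ k - 1.
    by rewrite -{2}(expr1n _ k) subrXX dvdp_mulr.
  apply: dvdp_trans (sub1 _ _).
  rewrite -(rmorph1 polyC) -nP1 rmorphXn /= subrXX; exact: dvdp_mulr.
by rewrite /D size_XnsubC.
Qed.

(** The map [z |-> z + z^Q] is the trace from [K] to [F_Q]. For [u] in [F_Q], the polynomial
    [D = X^Q + X - u] satisfies [D^Q - D = X^(Q^2) - X]. *)
Lemma card_trace_fiber (u : K) : u ^+ Q = u -> #|[set z : K | z + z ^+ Q == u]| = Q.
Proof.
move=> uQ; pose D : {poly K} := 'X^Q + ('X - u%:P).
have -> : [set z : K | z + z ^+ Q == u] = [set z | root D z].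
  apply/setP => z; rewrite !inE /root /D !hornerD hornerN hornerXn hornerX hornerC.
  by rewrite addrA subr_eq0 addrC.
have sD : size D = Q.+1.
  by rewrite size_polyDl ?size_polyXn // size_XsubC ltnS.
rewrite card_roots_dvdp ?sD //.
have -> : 'X^#|K| - 'X = D ^+ Q - D.
  rewrite (exprDp p_prime charPK) (exprBp p_prime charPK) -exprM QQ -rmorphXn /= uQ /D; ring.
by rewrite -(prednK (ltnW Q_gt1)) exprS -[X in _ - X]mulr1 -mulrBr dvdp_mulr.
Qed.

(** Each admissible [u] comes from [Q] elements [z]. The admissible [u] are 0 and, for each of the
    [p^(h-1) - 1] non-zero elements of trace zero in [F_P], its [P + 1] preimages under the norm. *)
Lemma card_affine_points_min :
  #|affine_points p h (1 : K)| = (Q * (1 + P.+1 * (p ^ h.-1 - 1)) * p)%N.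
Proof.
rewrite (card_affine_points p_prime charK cardK); congr (_ * _)%N.
pose S1 := [set n : K | ptrace p h n == 0].
pose S2 := [set u : K | u ^+ P.+1 \in S1].
have S1_0 : 0 \in S1.
  by rewrite inE /ptrace big1 // => i _; rewrite expr0n gtn_eqF // expn_gt0 prime_gt0.
have -> : [set al : K | ptrace p (4 * h) (1 * al ^+ P.+1) == 0] =
    (fun z => z + z ^+ Q) @^-1: S2.
  by apply/setP => z; rewrite !inE mul1r ptrace_4h.
rewrite (@card_fibers _ _ _ _ Q) => [|u]; last first.
  rewrite !inE => /eqP /ptrace_root_fixed uP; apply: card_trace_fiber.
  have [->|u0] := eqVneq u 0; first by rewrite expr0n gtn_eqF // ltnW.
  (* Cancelling [u^P] from [(u^(P+1))^P = u^(P+1)] leaves [u^(P^2) = u], so [u] lies in [F_Q]. *)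
  apply: (mulfI (expf_neq0 P u0)); rewrite -exprSr -[RHS]uP -exprM -exprD.
  by congr (_ ^+ _); rewrite -PP mulSn.
rewrite mulnC; congr (_ * _)%N.
have -> : S2 = 0 |: ((fun u => u ^+ P.+1) @^-1: (S1 :\ 0)).
  apply/setP => u; rewrite /S2 !in_setU1 !inE.
  have [->|u0] := eqVneq u 0; last by rewrite expf_eq0 (negPf u0).
  by rewrite expr0n /=; move: S1_0; rewrite inE => ->.
rewrite cardsU1 !inE expr0n eqxx /= add1n (@card_fibers _ _ _ _ P.+1).
  by rewrite mulnC -card_ptrace_roots -/S1 (cardsD1 0 S1) S1_0 addKn.
move=> n; rewrite !inE => /andP[n0 /eqP n_tr].
exact: card_pow_fiber n0 (ptrace_root_fixed n_tr).
Qed.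

End Minimal.

(** * The function field of y^p - y = a x^(p^h + 1) *)

Section Curve.

Variables (p h r : nat) (K : finFieldType) (F : fieldType).
Variables (iota : {rmorphism K -> F}) (x y : F) (a : K).
Hypotheses (p_prime : prime p) (charK : p \in [pchar K]) (h_gt0 : (0 < h)%N).
Hypotheses (cardK : #|K| = (p ^ r)%N) (a_neq0 : a != 0).
Hypothesis curve : is_function_field_CR iota p (a *: 'X^(p ^ h)) x y.

Local Notation m := (p ^ h).+1.

Definition evx : {poly K} -> F := horner_eval x \o map_poly iota.
HB.instance Definition _ := GRing.RMorphism.on evx.

(** The outer variable stands for [y] and the inner one for [x]. The body is convertible to [eval2],
    but written as a composition of ring morphisms, so that [ev] inherits that structure. *)
Definition ev : {poly {poly K}} -> F := horner_eval y \o map_poly evx.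
HB.instance Definition _ := GRing.RMorphism.on ev.

Lemma evx_eq0 f : evx f = 0 -> f = 0.
Proof. by case: curve => inj _ _; apply: inj. Qed.

Lemma evxC c : evx c%:P = iota c.
Proof. by rewrite /evx /= /horner_eval map_polyC hornerC. Qed.

Lemma evxX : evx 'X = x.
Proof. by rewrite /evx /= /horner_eval map_polyX hornerX. Qed.

Lemma evC f : ev f%:P = evx f.
Proof. by rewrite /ev /= /horner_eval map_polyC hornerC. Qed.

Lemma evX : ev 'X = y.
Proof. by rewrite /ev /= /horner_eval map_polyX hornerX. Qed.

Lemma curve_eq : y ^+ p - y = iota a * x ^+ m.
Proof.
case: curve => _ -> _; rewrite map_polyZ map_polyXn /= hornerZ hornerXn.
by rewrite exprS mulrCA.
Qed.

Lemma p_gt1 : (1 < p)%N. Proof. exact: prime_gt1. Qed.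
Lemma p_gt0 : (0 < p)%N. Proof. exact: prime_gt0. Qed.

Lemma pcharF : p \in [pchar F]. Proof. exact: rmorph_pchar charK. Qed.

Lemma x_neq0 : x != 0.
Proof.
by apply/eqP => x0; have := @evx_eq0 'X; rewrite evxX => /(_ x0)/eqP; rewrite polyX_eq0.
Qed.

Lemma y_neq0 : y != 0.
Proof.
apply/eqP => y0; have := curve_eq; rewrite y0 expr0n (gtn_eqF p_gt0) subr0 /=.
by move/esym/eqP; rewrite mulf_eq0 fmorph_eq0 (negPf a_neq0) expf_eq0 (negPf x_neq0) andbF.
Qed.

Lemma fracE z : exists u v, ev v != 0 /\ z = ev u / ev v.
Proof. by case: curve => _ _; apply. Qed.

Definition G : {poly {poly K}} := 'X^p - 'X - (a *: 'X^m)%:P.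

Lemma evG : ev G = 0.
Proof.
rewrite /G !rmorphB /= rmorphXn /= evX evC curve_eq -mul_polyC rmorphM rmorphXn /=.
by rewrite evxC evxX subrr.
Qed.

Lemma size_G_tail : (size ('X + (a *: 'X^m)%:P : {poly {poly K}})%R < p.+1)%N.
Proof.
rewrite (leq_ltn_trans (size_polyD _ _)) // gtn_max size_polyX ltnS p_gt1 /=.
by rewrite (leq_ltn_trans (size_polyC_leq1 _)) // ltnS p_gt0.
Qed.

Lemma size_G : size G = p.+1.
Proof.
rewrite /G -addrA -opprD size_polyDl size_polyXn // size_polyN; exact: size_G_tail.
Qed.

Lemma monic_G : G \is monic.
Proof.
by rewrite /G -addrA -opprD monicE lead_coefDl ?lead_coefXn // size_polyXn size_polyN
  size_G_tail.
Qed.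

Lemma ev_reduce (u : {poly {poly K}}) : exists q v : {poly {poly K}},
  [/\ (size v <= p)%N, u = q * G + v & ev u = ev v].
Proof.
exists (Pdiv.CommonRing.rdivp u G), (Pdiv.CommonRing.rmodp u G).
have uE := Pdiv.RingMonic.rdivp_eq monic_G u; split=> //.
  by rewrite -ltnS -size_G Pdiv.CommonRing.ltn_rmodp -size_poly_gt0 size_G.
by rewrite {1}uE rmorphD rmorphM /= evG mulr0 add0r.
Qed.

(** ** Infinite places *)

Definition infinite_place (O : set F) := is_place iota O /\ ~ O x.

(** The ring [K[1/x]] does not contain [x], because [x] is transcendental, so some place above it
    has [1/x] in its ideal. *)
Lemma infinite_place_exists : exists O, infinite_place O.
Proof.
pose B : set F := [set z | exists f : {poly K}, (map_poly iota f).[x^-1] = z]%classic.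
have subB : is_subring iota B.
  split=> [c|u v [f <-] [g <-]|u v [f <-] [g <-]].
  - by exists c%:P; rewrite map_polyC hornerC.
  - by exists (f - g); rewrite rmorphB !hornerE.
  - by exists (f * g); rewrite rmorphM !hornerE.
have Bt : B x^-1 by exists 'X; rewrite map_polyX hornerX.
have [|O [placeO BO mO]] := place_exists subB Bt; last first.
  exists O; split=> // Ox; apply: (place_ideal1 placeO).
  by rewrite -(mulfV x_neq0); apply: (place_idealMl placeO).
rewrite invrK; case=> f fx.
pose n := size f.
(* The relation [x = f(1/x)] multiplied by [x^n]: the subtracted polynomial is [X^n f(1/X)]. *)
pose g : {poly K} := 'X^(n.+1) - \poly_(i < n.+1) f`_(n - i).
have : evx g = 0.
  rewrite rmorphB /= rmorphXn /= evxX /evx /= /horner_eval.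
  rewrite (_ : map_poly iota _ = \poly_(i < n.+1) iota f`_(n - i)); last first.
    apply/polyP => i; rewrite coef_map !coef_poly /=.
    by case: ltnP => // _; rewrite rmorph0.
  rewrite horner_poly exprS -[X in X * _]fx.
  rewrite (horner_coef_wide _ (_ : (_ <= n.+1)%N)); last first.
    by rewrite size_map_poly leqnSn.
  rewrite mulr_suml (reindex_inj rev_ord_inj) /= -sumrB big1 // => i _.
  have le_in : (i <= n)%N by rewrite -ltnS.
  rewrite coef_map subSS exprVn -mulrA.
  rewrite (_ : x ^+ n = x ^+ (n - i) * x ^+ i); last by rewrite -exprD subnK.
  by rewrite mulKf ?subrr // expf_neq0 // x_neq0.
move/evx_eq0/(congr1 (fun q : {poly K} => q`_n.+1)).
rewrite coefB coefXn eqxx coef_poly ltnn subr0 coef0 => /eqP.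
by rewrite oner_eq0.
Qed.

Lemma infinite_place_y O : infinite_place O -> ~ O y.
Proof.
case=> placeO nx Oy; apply: nx; apply: (place_root placeO (ltn0Sn (p ^ h))).
rewrite -(mulKf (_ : iota a != 0) (x ^+ _)) ?fmorph_eq0 // -curve_eq -fmorphV.
apply: (placeM placeO); first exact: (place_iota placeO).
by apply: (placeB placeO) => //; apply: (placeX placeO).
Qed.

(* A local parameter at infinity: x has a pole of order p and y one of order m
   there, and p^h = m - 1. *)
Definition tinf : F := x ^+ (p ^ h.-1) / y.

Lemma tinf_neq0 : tinf != 0.
Proof. by rewrite mulf_neq0 ?invr_eq0 ?expf_neq0 ?x_neq0 ?y_neq0. Qed.

Lemma expnh : (p ^ h = p * p ^ h.-1)%N.
Proof. by rewrite -expnS prednK. Qed.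

(** By the equation of the curve, [a x t^p = a x^m / y^p = 1 - y^(1-p)], and [1/y] vanishes at
    [O]. *)
Lemma tinf_expn_x O : infinite_place O ->
  place_ideal O (iota a * x * tinf ^+ p - 1).
Proof.
move=> infO; have ny := infinite_place_y infO; case: infO => placeO nx.
rewrite /tinf expr_div_n -exprM mulnC -expnh mulrA -[_ * x * _]mulrA -exprS -curve_eq.
have y0 := y_neq0.
have -> : (y ^+ p - y) / y ^+ p - 1 = - (y^-1) ^+ p.-2.+1.
  rewrite mulrBl mulfV ?expf_neq0 // addrAC subrr add0r.
  have -> : y ^+ p = y ^+ p.-2.+1 * y.
    by rewrite -exprSr; congr (_ ^+ _); have := p_gt1; case: (p) => [|[]].
  by rewrite exprVn; field; rewrite y0 expf_neq0.
apply: (place_idealN placeO); apply: (place_ideal_expS placeO).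
exact: (place_idealV placeO ny).
Qed.

Lemma tinf_ideal O : infinite_place O -> place_ideal O tinf.
Proof.
move=> infO; have tx := tinf_expn_x infO; case: infO => placeO nx.
apply/(place_idealE placeO); right=> Ot; apply: nx.
have t0 := tinf_neq0.
rewrite (_ : x = iota a^-1 * (tinf^-1 ^+ p) * (iota a * x * tinf ^+ p)).
  apply: (placeM placeO); last exact: (one_unit_place placeO tx).
  by apply: (placeM placeO); [exact: (place_iota placeO) | apply: (placeX placeO)].
by rewrite fmorphV exprVn; field; rewrite expf_neq0 // fmorph_eq0.
Qed.

(* z = c t^k (1 + terms vanishing at infinity); the quantification over O makes
   c and k independent of the choice of an infinite place. *)
Definition leads z (c : K) (k : int) := c != 0 /\
  forall O, infinite_place O -> place_ideal O (z / (iota c * tinf ^ k) - 1).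

Lemma leads_neq0 z c k : leads z c k -> z != 0.
Proof.
case=> c0 lz; have [O infO] := infinite_place_exists.
have := lz O infO; case: infO => placeO _ /(one_unit_neq0 placeO).
by rewrite mulf_eq0 negb_or => /andP[].
Qed.

Lemma tinf_expz_neq0 k : tinf ^ k != 0.
Proof. by rewrite expfz_neq0 // tinf_neq0. Qed.

Lemma leadsM z w c d k l : leads z c k -> leads w d l -> leads (z * w) (c * d) (k + l).
Proof.
move=> [c0 lz] [d0 lw]; split; first exact: mulf_neq0.
move=> O infO; have {}lz := lz O infO; have {}lw := lw O infO.
case: infO => placeO _; have := one_unitM placeO lz lw.
by rewrite rmorphM expfzDr ?tinf_neq0 // mulf_div; congr place_ideal; rewrite mulrACA.
Qed.

Lemma leadsV z c k : leads z c k -> leads z^-1 c^-1 (- k).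
Proof.
move=> lz; have z0 := leads_neq0 lz; case: lz => c0 lz; split; first by rewrite invr_eq0.
move=> O infO; have {}lz := lz O infO; case: infO => placeO _.
have := one_unitV placeO lz; rewrite fmorphV -invr_expz; congr place_ideal.
by congr (_ - 1); field; rewrite z0 tinf_expz_neq0 fmorph_eq0 c0 oner_neq0.
Qed.

Lemma leadsX z c k n : leads z c k -> leads (z ^+ n) (c ^+ n) (k * n%:Z).
Proof.
move=> [c0 lz]; split; first exact: expf_neq0.
move=> O infO; have {}lz := lz O infO; case: infO => placeO _.
have := one_unitX placeO n lz.
by rewrite expr_div_n exprMn rmorphXn /= -exprz_exp -exprnP.
Qed.

Lemma leads_iota c : c != 0 -> leads (iota c) c 0.
Proof.
move=> c0; split=> // O [placeO _]; rewrite expr0z mulr1 divff ?fmorph_eq0 // subrr.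
exact: (place_ideal0 placeO).
Qed.

Lemma leads_tinf : leads tinf 1 1.
Proof.
split; first exact: oner_neq0.
move=> O [placeO _]; rewrite rmorph1 mul1r expr1z divff ?tinf_neq0 // subrr.
exact: (place_ideal0 placeO).
Qed.

Lemma leads_x : leads x a^-1 (- p%:Z).
Proof.
split; first by rewrite invr_eq0.
move=> O /tinf_expn_x; congr place_ideal; rewrite -exprnN fmorphV.
by congr (_ - 1); field; rewrite expf_neq0 ?tinf_neq0 ?oner_neq0 ?fmorph_eq0 ?a_neq0.
Qed.

Lemma leads_y : exists2 c, c != 0 & leads y c (- m%:Z).
Proof.
have := leadsM (leadsX (p ^ h.-1) leads_x) (leadsV leads_tinf).
rewrite /tinf invf_div mulrCA mulfV ?expf_neq0 ?x_neq0 // mulr1 invr1 mulr1.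
have -> : - p%:Z * (p ^ h.-1)%N%:Z + - 1%:Z = - m%:Z.
  by rewrite expnh; nia.
by exists (a^-1 ^+ (p ^ h.-1)) => //; rewrite expf_neq0 // invr_eq0.
Qed.

Lemma leads_mon i j : exists2 c, c != 0 & leads (x ^+ i * y ^+ j) c (- (i * p + j * m)%N%:Z).
Proof.
have [c c0 ly] := leads_y; exists (a^-1 ^+ i * c ^+ j).
  by rewrite mulf_neq0 ?expf_neq0 // invr_eq0.
have := leadsM (leadsX i leads_x) (leadsX j ly); congr leads; lia.
Qed.

Lemma leads_one_unit z c k O : leads z c k -> infinite_place O ->
  exists2 e, place_ideal O (e - 1) & z = iota c * tinf ^ k * e.
Proof.
move=> lz infO; have z0 := leads_neq0 lz; case: lz => c0 /(_ O infO) lz.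
exists (z / (iota c * tinf ^ k)) => //.
by rewrite mulrC divfK // mulf_neq0 ?tinf_expz_neq0 // fmorph_eq0.
Qed.

Lemma leads_ideal_pos z c k O : leads z c k -> infinite_place O -> 0 < k -> place_ideal O z.
Proof.
move=> lz infO; have [e me ->] := leads_one_unit lz infO; have tO := tinf_ideal infO.
case: infO => placeO nx; case: k lz => [[|n]|n] lz // _.
apply: (place_idealMr placeO) => //; first exact: (one_unit_place placeO me).
apply: (place_idealMl placeO) => //; first exact: (place_iota placeO).
exact: (place_ideal_expS placeO).
Qed.

(** Membership depends on the sign of [k] alone and not on [O]; this is what makes the infinite
    place unique once every non-zero function has a leading term. *)
Lemma leads_place z c k O : leads z c k -> infinite_place O -> O z <-> 0 <= k.
Proof.
move=> lz infO; have z0 := leads_neq0 lz; case: (infO) => placeO nx.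
case: (ltrgtP k 0) => k0.
- split=> // Oz; exfalso; apply: (place_ideal1 placeO); rewrite -(mulfV z0).
  apply: (place_idealMl placeO) => //; apply: leads_ideal_pos (leadsV lz) infO _.
  by rewrite oppr_gt0.
- by split=> // _; apply: (@place_ideal_sub _ O); apply: leads_ideal_pos lz infO k0.
- split=> // _; rewrite k0 in lz; have [e me ->] := leads_one_unit lz infO.
  rewrite expr0z mulr1; apply: (placeM placeO); first exact: (place_iota placeO).
  exact: (one_unit_place placeO me).
Qed.

Lemma leads_ideal z c k O : leads z c k -> infinite_place O -> place_ideal O z <-> 0 < k.
Proof.
move=> lz infO; split; last exact: leads_ideal_pos lz infO.
move=> mz; have z0 := leads_neq0 lz; case: (infO) => placeO nx.
rewrite ltNge -oppr_ge0; apply/negP => /(leads_place (leadsV lz) infO) OV.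
by apply: (place_ideal1 placeO); rewrite -(mulVf z0); apply: (place_idealMl placeO).
Qed.

Lemma leads_uniq z c d k l : leads z c k -> leads z d l -> k = l.
Proof.
move=> lz lz'; have [O infO] := infinite_place_exists; have [placeO _] := infO.
have z0 := leads_neq0 lz.
have := leads_place (leadsM lz (leadsV lz')) infO.
have := leads_place (leadsM lz' (leadsV lz)) infO.
rewrite mulfV // => -[/(_ (place1 placeO)) h1 _] [/(_ (place1 placeO)) h2 _].
by lia.
Qed.

(** As [m = p^h + 1] is 1 modulo [p], the weight determines [j < p] as its residue. *)
Lemma weight_inj i j i' j' : (j < p)%N -> (j' < p)%N ->
  (i * p + j * m = i' * p + j' * m)%N -> i = i' /\ j = j'.
Proof.
move=> jp j'p e.
have w_divmod k l : (k * p + l * m = (k + l * p ^ h.-1) * p + l)%N.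
  by rewrite mulnS expnh; nia.
rewrite !w_divmod in e.
have jj' : j = j'.
  by have := congr1 (modn^~ p) e; rewrite !modnMDl !modn_small.
split=> //; move: e; rewrite jj' => /addIn/eqP.
by rewrite eqn_pmul2r ?p_gt0 // eqn_add2r => /eqP.
Qed.

Lemma ev_sum (u : {poly {poly K}}) n l : (size u <= l)%N -> (sizeY u <= n)%N ->
  ev u = \sum_(ij : 'I_n * 'I_l) iota u`_ij.2`_ij.1 * (x ^+ ij.1 * y ^+ ij.2).
Proof.
move=> sl sn; rewrite -(pair_big predT predT (fun (i : 'I_n) (j : 'I_l) =>
  iota u`_j`_i * (x ^+ i * y ^+ j))) /= exchange_big /=.
rewrite /ev /= /horner_eval (horner_coef_wide _ (leq_trans (size_poly _ _) sl)).
apply: eq_bigr => j _; rewrite coef_map /= /evx /= /horner_eval.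
have sj : (size (map_poly iota u`_j) <= n)%N.
  by rewrite size_map_poly (leq_trans (max_size_coefXY _ _)).
rewrite (horner_coef_wide _ sj) mulr_suml; apply: eq_bigr => i _.
by rewrite coef_map mulrA.
Qed.

(** The heaviest monomial is unique by [weight_inj], and the quotients of the others by it vanish at
    infinity. The last clause, which bounds every monomial by the order of [ev u], is what later
    controls derivatives and regular differentials. *)
Lemma leads_ev (u : {poly {poly K}}) : (size u <= p)%N -> u != 0 ->
  exists i j c, [/\ u`_j`_i != 0, leads (ev u) c (- (i * p + j * m)%N%:Z)
    & forall i' j', u`_j'`_i' != 0 -> (i' * p + j' * m <= i * p + j * m)%N].
Proof.
move=> su u0; pose n := sizeY u.
pose w (ij : 'I_n * 'I_p) := (ij.1 * p + ij.2 * m)%N.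
pose nz (ij : 'I_n * 'I_p) := u`_ij.2`_ij.1 != 0.
have inj_w : injective w.
  move=> [i j] [i' j'] /(weight_inj (ltn_ord j) (ltn_ord j')) [/= ii' jj'].
  by congr pair; apply: val_inj.
have nzE i j : u`_j`_i != 0 ->
    exists ij : 'I_n * 'I_p, [/\ nz ij, ij.1 = i :> nat & ij.2 = j :> nat].
  move=> uij; have jp : (j < p)%N.
    rewrite ltnNge; apply/negP => pj.
    by rewrite (nth_default _ (leq_trans su pj)) coef0 eqxx in uij.
  have iN : (i < n)%N.
    rewrite ltnNge; apply/negP => ni.
    by rewrite (nth_default _ (leq_trans (max_size_coefXY _ _) ni)) eqxx in uij.
  by exists (Ordinal iN, Ordinal jp).
have [ij0 nz0] : exists ij, nz ij.
  have l0 : lead_coef (lead_coef u) != 0 by rewrite !lead_coef_eq0.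
  by have [ij [? _ _]] := nzE _ _ l0; exists ij.
case: (arg_maxnP w nz0) => -[i j] nzij maxij.
have [d d0 ld] := leads_mon i j.
exists i, j, (u`_j`_i * d); split=> //; last first.
  by move=> i' j' /nzE [ij [/maxij + <- <-]].
have lm : leads (iota u`_j`_i * (x ^+ i * y ^+ j)) (u`_j`_i * d) (- (i * p + j * m)%N%:Z).
  by rewrite -[- _]add0r; apply: leadsM => //; apply: leads_iota.
split; first by rewrite mulf_neq0.
move=> O infO; have [placeO _] := infO; have lO := lm.2 O infO.
rewrite (ev_sum su (leqnn _)) (bigD1 (i, j)) //= mulrDl addrAC.
apply: (place_idealD placeO) => //; rewrite mulr_suml.
apply: (place_ideal_sum placeO) => -[i' j'] /= neq.
have [->|u'0] := eqVneq u`_j'`_i' 0.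
  by rewrite rmorph0 !mul0r; exact: (place_ideal0 placeO).
have [d' d'0 ld'] := leads_mon i' j'.
have lm' := leadsM (leadsM (leads_iota u'0) ld') (leadsV (leadsM (leads_iota lm.1)
  (leadsX (i * p + j * m) (leadsV leads_tinf)))).
move: lm'; rewrite -exprnN in lm *; rewrite exprVn => lm'.
apply: leads_ideal_pos lm' infO _.
have : (w (i', j') < w (i, j))%N.
  by rewrite ltn_neqAle (inj_eq inj_w) neq; apply: (maxij (i', j') u'0).
rewrite /w /=; move: (i' * p + j' * m)%N (i * p + j * m)%N => w1 w2; clear - w1 w2; lia.
Qed.

Lemma ev_inj (u : {poly {poly K}}) : (size u <= p)%N -> ev u = 0 -> u = 0.
Proof.
move=> su eu; apply/eqP; apply: contraT => u0.
by have [i [j [c [_ /leads_neq0]]]] := leads_ev su u0; rewrite eu eqxx.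
Qed.

(** Thus [K[x, y]] is [K[X, Y] / (G)]: evaluation at a point of the curve, and any derivation
    killing [G], descend to it. *)
Lemma ev_ker (u : {poly {poly K}}) : ev u = 0 -> exists q, u = q * G.
Proof.
have [q [v [sv -> ->]]] := ev_reduce u; move/(ev_inj sv) => ->.
by exists q; rewrite addr0.
Qed.

Lemma leads_exists z : z != 0 -> exists c k, leads z c k.
Proof.
have [u [v [ev0 ->]]] := fracE z.
have [_ [u' [su' _ uE]]] := ev_reduce u; have [_ [v' [sv' _ vE]]] := ev_reduce v.
rewrite {}uE {}vE in ev0 *; move=> uv0.
have u'0 : u' != 0 by apply: contraNneq uv0 => ->; rewrite rmorph0 mul0r.
have v'0 : v' != 0 by apply: contraNneq ev0 => ->; rewrite rmorph0.
have [i [j [c [_ lu _]]]] := leads_ev su' u'0.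
have [i' [j' [d [_ lv _]]]] := leads_ev sv' v'0.
by exists (c / d), (- (i * p + j * m)%N%:Z - (- (i' * p + j' * m)%N%:Z));
  apply: leadsM => //; apply: leadsV.
Qed.

Lemma infinite_place_uniq O O' : infinite_place O -> infinite_place O' -> O = O'.
Proof.
move=> infO infO'; apply/funext => z; apply/propext.
have [->|z0] := eqVneq z 0.
  by split=> _; [exact: (place0 infO'.1) | exact: (place0 infO.1)].
have [c [k lz]] := leads_exists z0.
by rewrite (leads_place lz infO) (leads_place lz infO').
Qed.

Lemma infinite_place_rational O : infinite_place O -> rational_places iota O.
Proof.
move=> infO; split; first exact: infO.1.
move=> z Oz; have [->|z0] := eqVneq z 0.
  by exists 0; rewrite rmorph0 subrr; exact: (place_ideal0 infO.1).
have [c [k lz]] := leads_exists z0.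
have : 0 <= k by apply/(leads_place lz infO).
rewrite le_eqVlt => /orP[/eqP k0|k0]; last first.
  by exists 0; rewrite rmorph0 subr0; apply: leads_ideal_pos lz infO k0.
rewrite -k0 in lz; have [e me ->] := leads_one_unit lz infO; exists c.
rewrite expr0z mulr1 -[X in _ - X]mulr1 -mulrBr.
by apply: (place_idealMl infO.1) => //; apply: (place_iota infO.1).
Qed.

(** ** Finite places *)

Lemma pchar_polyK : p \in [pchar {poly K}].
Proof. by rewrite pchar_poly. Qed.

(** If [y] had a pole, then [1 = a x^m y^(-p) + y^(1-p)] would lie in the ideal of [O]. *)
Lemma place_finite_y O : is_place iota O -> O x -> O y.
Proof.
move=> placeO Ox; apply: contrapT => ny; apply: (place_ideal1 placeO).
have my := place_idealV placeO ny; have y0 := y_neq0.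
have pE : p = p.-2.+2 by have := p_gt1; case: (p) => [|[]].
have -> : 1 = iota a * x ^+ m * y^-1 ^+ p + y^-1 ^+ p.-2.+1.
  by rewrite -curve_eq pE /= !exprVn !exprS; field; rewrite y0 expf_neq0.
apply: (place_idealD placeO); last exact: (place_ideal_expS placeO).
apply: (place_idealMl placeO).
  apply: (placeM placeO); [exact: (place_iota placeO) | exact: (placeX placeO)].
by rewrite pE; apply: (place_ideal_expS placeO).
Qed.

Lemma place_evx O f : is_place iota O -> O x -> O (evx f).
Proof.
move=> placeO Ox; elim/poly_ind: f => [|f c IH].
  by rewrite rmorph0; exact: (place0 placeO).
rewrite rmorphD rmorphM /= evxX evxC; apply: (placeD placeO); last exact: (place_iota placeO).
exact: (placeM placeO).
Qed.

Lemma place_ev O u : is_place iota O -> O x -> O (ev u).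
Proof.
move=> placeO Ox; elim/poly_ind: u => [|u f IH].
  by rewrite rmorph0; exact: (place0 placeO).
rewrite rmorphD rmorphM /= evX evC; apply: (placeD placeO); last exact: place_evx.
by apply: (placeM placeO) => //; exact: place_finite_y.
Qed.

(** For [k > 0] this is the product of all monic irreducible polynomials of degree dividing [k]. It
    is squarefree, and powers of such polynomials serve as denominators for all functions, without
    any factorization. *)
Definition fermat_poly k : {poly K} := 'X^(#|K| ^ k) - 'X.

Lemma card_gt1 : (1 < #|K|)%N.
Proof. exact: finNzRing_gt1. Qed.

Lemma expf_cardX (c : K) k : c ^+ (#|K| ^ k) = c.
Proof. by elim: k => [|k IH]; rewrite ?expr1 // expnS exprM expf_card. Qed.

Lemma fermat_poly_neq0 k : (0 < k)%N -> fermat_poly k != 0.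
Proof.
move=> k0; rewrite -size_poly_eq0 /fermat_poly.
rewrite size_polyDl ?size_polyXn // size_polyN size_polyX.
by rewrite ltnS (leq_ltn_trans k0) // ltn_expl // card_gt1.
Qed.

Lemma evx_fermat_neq0 k : (0 < k)%N -> evx (fermat_poly k) != 0.
Proof. by move=> /fermat_poly_neq0; apply: contra_neq; apply: evx_eq0. Qed.

Lemma fermat_poly_dvd k f : exists w, f ^+ (#|K| ^ k) - f = fermat_poly k * w.
Proof.
set N := (#|K| ^ k)%N; have NE : N = (p ^ (r * k))%N by rewrite /N cardK expnM.
elim/poly_ind: f => [|f c [w IH]].
  by exists 0; rewrite mulr0 subr0 expr0n gtn_eqF // expn_gt0 (ltnW card_gt1).
exists (w * 'X^N + f).
have -> : (f * 'X + c%:P) ^+ N = f ^+ N * 'X^N + c%:P.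
  by rewrite NE (exprDp p_prime pchar_polyK) exprMn -NE -rmorphXn /= expf_cardX.
rewrite mulrDr mulrA -IH /fermat_poly -/N; ring.
Qed.

Lemma fermat_poly_dvd_iter k i f : exists w, f ^+ ((#|K| ^ k) ^ i) - f = fermat_poly k * w.
Proof.
elim: i => [|i [w IH]]; first by exists 0; rewrite expr1 subrr mulr0.
have [w' IH'] := fermat_poly_dvd k (f ^+ ((#|K| ^ k) ^ i)).
by exists (w' + w); rewrite mulrDr -IH -IH' expnSr exprM; ring.
Qed.

Lemma evx_monomial c n : evx (c *: 'X^n) = iota c * x ^+ n.
Proof. by rewrite -mul_polyC rmorphM rmorphXn /= evxC evxX. Qed.

Lemma y_frobenius n : exists f, y ^+ (p ^ n) = y + evx f.
Proof.
elim: n => [|n [f IH]]; first by exists 0; rewrite expr1 rmorph0 addr0.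
exists ((a *: 'X^m) + f ^+ p).
rewrite expnSr exprM IH -[X in _ ^+ X](expn1 p) (exprDp p_prime pcharF) expn1.
rewrite -[y ^+ p](subrK y) curve_eq rmorphD rmorphXn /= evx_monomial.
ring.
Qed.

(** With [N = q^k], the [N]-th power map fixes [f(x)] modulo [x^N - x] and adds it to [y], hence
    adds [i f(x)] after [i] iterations. For [i = p] nothing is added, which is the origin of the
    exponent [(q^k)^p] below. *)
Lemma y_frobenius_iter k : exists f, forall i, exists w,
  y ^+ ((#|K| ^ k) ^ i) - (y + i%:R * evx f) = evx (fermat_poly k) * ev w.
Proof.
set N := (#|K| ^ k)%N; have NE : N = (p ^ (r * k))%N by rewrite /N cardK expnM.
have N0 : (0 < N)%N by rewrite expn_gt0 (ltnW card_gt1).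
have [f yN] := y_frobenius (r * k); exists f; elim=> [|i [w IH]].
  by exists 0; rewrite expr1 mul0r addr0 subrr rmorph0 mulr0.
have [g gE] := fermat_poly_dvd k f.
exists (i%:R * g%:P + (fermat_poly k ^+ N.-1)%:P * w ^+ N).
have yE : y ^+ (N ^ i) = y + i%:R * evx f + evx (fermat_poly k) * ev w.
  by rewrite -IH addrC subrK.
have iN : (i%:R : F) ^+ N = i%:R.
  by rewrite NE -[i%:R in LHS](rmorph_nat iota) -rmorphXn /= -NE expf_cardX rmorph_nat.
have fN : evx f ^+ N = evx f + evx (fermat_poly k) * evx g.
  by rewrite -rmorphM -gE rmorphB rmorphXn /= addrC subrK.
have -> : ev (i%:R * g%:P + (fermat_poly k ^+ N.-1)%:P * w ^+ N) =
    i%:R * evx g + evx (fermat_poly k) ^+ N.-1 * ev w ^+ N.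
  rewrite rmorphD; congr (_ + _); rewrite [LHS]rmorphM /= evC.
    by rewrite rmorph_nat.
  by rewrite !rmorphXn.
have addN (u v : F) : (u + v) ^+ N = u ^+ N + v ^+ N by rewrite NE (exprDp p_prime pcharF).
have yN' : y ^+ N = y + evx f by rewrite NE.
rewrite expnSr exprM yE !addN !exprMn iN fN yN' -natr1.
have -> : evx (fermat_poly k) ^+ N = evx (fermat_poly k) * evx (fermat_poly k) ^+ N.-1.
  by rewrite -exprS prednK.
by ring.
Qed.

(* K[x, y] is unramified over K[x], so K[x, y]/(x^N - x) is a finite reduced ring,
   and some power of the Frobenius is the identity on it. *)
Lemma ev_frobenius k u : exists w,
  ev u ^+ ((#|K| ^ k) ^ p) - ev u = evx (fermat_poly k) * ev w.
Proof.
set M := ((#|K| ^ k) ^ p)%N; have ME : M = (p ^ (r * k * p))%N.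
  by rewrite /M cardK -!expnM mulnA.
elim/poly_ind: u => [|u f [w IH]].
  by exists 0; rewrite rmorph0 mulr0 subr0 expr0n gtn_eqF // ME expn_gt0 p_gt0.
have [f0 /(_ p) [w0 yE]] := y_frobenius_iter k.
have [g gE] := fermat_poly_dvd_iter k p f.
rewrite (pcharf0 pcharF) mul0r addr0 -/M in yE; rewrite -/M in gE.
exists (u ^+ M * w0 + w * 'X + g%:P).
have gE' : evx (fermat_poly k) * evx g = evx f ^+ M - evx f.
  by rewrite -rmorphM -gE rmorphB rmorphXn.
have addM (v w' : F) : (v + w') ^+ M = v ^+ M + w' ^+ M by rewrite ME (exprDp p_prime pcharF).
have -> : ev (u ^+ M * w0 + w * 'X + g%:P) = ev u ^+ M * ev w0 + ev w * y + evx g.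
  by rewrite 2!rmorphD 2!rmorphM /= evX evC rmorphXn.
have -> : ev (u * 'X + f%:P) = ev u * y + evx f by rewrite rmorphD rmorphM /= evX evC.
by rewrite !mulrDr gE' mulrCA -yE mulrA -IH addM exprMn; ring.
Qed.

Lemma ev_frobenius_iter k i u : exists w,
  ev u ^+ (((#|K| ^ k) ^ p) ^ i) - ev u = evx (fermat_poly k) * ev w.
Proof.
elim: i => [|i [w IH]]; first by exists 0; rewrite expr1 subrr rmorph0 mulr0.
have [w' IH'] := ev_frobenius k (u ^+ (((#|K| ^ k) ^ p) ^ i)).
exists (w' + w); have -> : ev (w' + w) = ev w' + ev w by exact: rmorphD.
by rewrite mulrDr -IH -IH' rmorphXn /= expnSr exprM; ring.
Qed.

(* Pigeonhole: the powers X^(q^i) are not all distinct modulo g. *)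
Lemma dvd_fermat_poly (g : {poly K}) : g != 0 ->
  exists k n, (0 < k)%N /\ g %| fermat_poly k ^+ n.
Proof.
move=> g0; pose d := size g.
pose f (i : 'I_(#|{: 'rV[K]_d}|.+1)) : 'rV[K]_d := poly_rV ('X^(#|K| ^ i) %% g).
have /injectivePn [i [j neq fij]] : ~~ injectiveb f.
  by apply/injectiveP => /leq_card; rewrite card_ord ltnn.
wlog ltij : i j neq fij / (i < j)%N.
  move=> IH; case: (ltngtP i j) => [lt|lt|/val_inj eq].
  - exact: (IH i j).
  - by apply: (IH j i) => //; rewrite eq_sym.
  - by rewrite eq eqxx in neq.
(* For [i < j], the difference [X^(q^j) - X^(q^i)] is the [q^i]-th power of [X^(q^(j-i)) - X]. *)
exists (j - i)%N, (#|K| ^ i)%N; split; first by rewrite subn_gt0.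
have szm (u : {poly K}) : (size (modp u g) <= d)%N by rewrite ltnW // ltn_modp.
have : ('X^(#|K| ^ j) - 'X^(#|K| ^ i)) %% g = 0.
  rewrite modpD modpN -[X in X - _](poly_rV_K (szm _)) -[X in _ - X](poly_rV_K (szm _)).
  by rewrite -/(f i) -/(f j) fij subrr.
move/eqP; rewrite -/(_ %| _); congr (_ %| _).
rewrite /fermat_poly cardK -!expnM (exprBp p_prime pchar_polyK) -exprM -expnD -mulnDr.
by rewrite subnK // ltnW.
Qed.

Lemma ev_integral (v : {poly {poly K}}) : integralOver evx (ev v).
Proof.
have inty : integralOver evx y.
  apply: (@integral_root_monic _ _ _ _ (map_poly evx G)).
  - by apply: monic_map; exact: monic_G.
  - by apply/rootP; exact: evG.
  - by apply/integral_poly => i; rewrite coef_map; exact: integral_id.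
elim/poly_ind: v => [|v f IH]; first by rewrite rmorph0; exact: integral0.
rewrite rmorphD rmorphM /= evX evC; apply: integral_add; last exact: integral_id.
exact: integral_mul.
Qed.

(** An integral equation of [ev v], once cancelled by [ev v] until its constant term [c] is
    non-zero, reads [P(v) v + c = 0]. *)
Lemma ev_dvd_poly (v : {poly {poly K}}) : ev v != 0 ->
  exists w g, g != 0 /\ ev v * ev w = evx g.
Proof.
move=> v0; have [P monP /rootP rootP] := ev_integral v.
have P0 := monic_neq0 monP.
elim/poly_ind: P {monP} P0 rootP => [|P c IH]; first by rewrite eqxx.
have [->|c0] := eqVneq c 0.
  rewrite addr0 mulf_eq0 negb_or => /andP[P0 _].
  rewrite rmorphM /= map_polyX hornerMX => /eqP.
  by rewrite mulf_eq0 (negPf v0) orbF => /eqP; apply: IH.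
move=> _; rewrite rmorphD rmorphM /= map_polyX map_polyC hornerD hornerC hornerMX => e.
exists (- (P \Po v)), c; split=> //.
have -> : ev (- (P \Po v)) = - (map_poly evx P).[ev v].
  by rewrite rmorphN /= {1}/ev /= /horner_eval map_comp_poly horner_comp.
by rewrite mulrN; apply/eqP; rewrite eq_sym -addr_eq0 addrC mulrC e.
Qed.

Lemma frac_fermat z : exists u k n, (0 < k)%N /\ z = ev u / evx (fermat_poly k) ^+ n.
Proof.
have [u [v [v0 ->]]] := fracE z.
have [w [g [g0 vw]]] := ev_dvd_poly v0.
have [k [n [k0 /dvdpP [q qE]]]] := dvd_fermat_poly g0.
have P0 : evx (fermat_poly k) ^+ n != 0 by rewrite expf_neq0 // evx_fermat_neq0.
exists (u * w * q%:P), k, n; split=> //.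
rewrite !rmorphM /= evC; apply: (mulIf P0); rewrite divfK // -rmorphXn /= qE rmorphM /= -vw.
by field.
Qed.

Definition finite_place (O : set F) := is_place iota O /\ O x.

(** Let [Pi] vanish at [O] and [z = u / (s Pi^(n+1))] be in [O]; then [u] vanishes at [O]. By
    [ev_frobenius], [u (u^(M-1) - 1) = Pi w], and [u^(M-1) - 1] is a unit of [O], so one factor [Pi]
    cancels at the price of this unit in the denominator. *)
Lemma finite_place_local O z : finite_place O -> O z ->
  exists u s, ~ place_ideal O (ev s) /\ z = ev u / ev s.
Proof.
case=> placeO Ox; have [u [k [n [k0 ->]]]] := frac_fermat z.
have P0 := evx_fermat_neq0 k0; set Pi := evx _ in P0 *.
have OPi : O Pi by exact: place_evx.
have [mPi|nPi] := pselect (place_ideal O Pi); last first.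
  move=> _; exists u, ((fermat_poly k)%:P ^+ n); rewrite rmorphXn /= evC; split=> //.
  by move/(place_idealX placeO OPi).
have neq0 s : ~ place_ideal O (ev s) -> ev s != 0.
  by move=> ns; apply/eqP => s0; apply: ns; rewrite s0; exact: (place_ideal0 placeO).
have main s : ~ place_ideal O (ev s) -> O (ev u / (ev s * Pi ^+ n)) ->
    exists u' s', ~ place_ideal O (ev s') /\ ev u / (ev s * Pi ^+ n) = ev u' / ev s'.
  elim: n u s => [|n IH] u s ns Oz; first by exists u, s; rewrite expr0 mulr1.
  have s0 := neq0 _ ns.
  have mu : place_ideal O (ev u).
    rewrite (_ : ev u = ev u / (ev s * Pi ^+ n.+1) * ev s * Pi ^+ n * Pi); last first.
      by rewrite exprS; field; rewrite s0 P0 expf_neq0.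
    apply: (place_idealMl placeO) => //; apply: (placeM placeO); last exact: (placeX placeO).
    by apply: (placeM placeO) => //; exact: place_ev.
  have [w wE] := ev_frobenius k u; rewrite -/Pi in wE.
  have MS : ((#|K| ^ k) ^ p)%N = ((#|K| ^ k) ^ p).-2.+2.
    have : (1 < (#|K| ^ k) ^ p)%N.
      rewrite -expnM (leq_ltn_trans _ (ltn_expl (k * p) card_gt1)) // muln_gt0 k0 p_gt0 //.
    by case: (_ ^ _)%N => [|[]].
  set N := ((#|K| ^ k) ^ p).-2 in MS.
  have eE : ev (u ^+ N.+1 - 1) = ev u ^+ N.+1 - 1.
    by rewrite rmorphB rmorphXn rmorph1.
  have ns' : ~ place_ideal O (ev (u ^+ N.+1 - 1)).
    move=> mm; apply: (place_ideal1 placeO).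
    rewrite (_ : 1 = ev u ^+ N.+1 - ev (u ^+ N.+1 - 1)); last first.
      by rewrite eE; ring.
    by apply: (place_idealB placeO) => //; exact: (place_ideal_expS placeO).
  have s'0 := neq0 _ ns'.
  have E : ev u / (ev s * Pi ^+ n.+1) = ev w / (ev ((u ^+ N.+1 - 1) * s) * Pi ^+ n).
    have uE : ev u * ev (u ^+ N.+1 - 1) = Pi * ev w.
      by rewrite -wE MS eE [ev u ^+ N.+2]exprS; ring.
    rewrite (_ : ev u = Pi * ev w / ev (u ^+ N.+1 - 1)); last by rewrite -uE mulfK.
    have -> : ev ((u ^+ N.+1 - 1) * s) = ev (u ^+ N.+1 - 1) * ev s by exact: rmorphM.
    move: (ev (u ^+ N.+1 - 1)) s'0 => e e0.
    by rewrite [Pi ^+ n.+1]exprS; field; rewrite s0 e0 P0 expf_neq0.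
  rewrite E in Oz *; apply: IH => //; rewrite rmorphM /=.
  by move/(place_ideal_prime placeO (place_ev _ placeO Ox)) => [].
move=> Oz; have := main 1; rewrite rmorph1 mul1r; apply=> //; exact: (place_ideal1 placeO).
Qed.

(** A place above [K[x, y][1/u]] at which [Pi] vanishes would contain [u / Pi] and [1/u], hence
    [1/Pi]. So [Pi] is invertible in that ring, that is [u^n = Pi w] for some [n]. As [u] is
    congruent modulo [Pi] to [u^M] for some [M >= n], it is itself divisible by [Pi]. *)
Lemma finite_places_dvd k u : (0 < k)%N ->
    (forall O, finite_place O -> O (ev u / evx (fermat_poly k))) ->
  exists w, ev u = evx (fermat_poly k) * ev w.
Proof.
move=> k0 Ou; have P0 := evx_fermat_neq0 k0; set Pi := evx _ in P0 Ou *.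
apply: contrapT => nex.
have u0 : ev u != 0 by apply/eqP => u0; apply: nex; exists 0; rewrite u0 rmorph0 mulr0.
pose B : set F := [set z | exists w n, z = ev w / ev u ^+ n]%classic.
have uX n : ev u ^+ n != 0 by rewrite expf_neq0.
have evB w : B (ev w) by exists w, 0%N; rewrite expr0 divr1.
have subB : is_subring iota B.
  split=> [c|_ _ [v [n ->]] [w [l ->]]|_ _ [v [n ->]] [w [l ->]]].
  - by rewrite -evxC -evC.
  - exists (v * u ^+ l - w * u ^+ n), (n + l)%N.
    by rewrite rmorphB !rmorphM !rmorphXn /= exprD; field; rewrite !uX.
  - exists (v * w), (n + l)%N.
    by rewrite rmorphM /= exprD; field; rewrite !uX.
have BPi : B Pi by rewrite /Pi -evC.
have [|O [placeO BO mPi]] := place_exists subB BPi.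
  case=> w [n wE]; apply: nex.
  have [w' w'E] := ev_frobenius_iter k n u; rewrite -/Pi in w'E.
  set M := (_ ^ n)%N in w'E.
  have nM : (n <= M)%N.
    apply/ltnW/ltn_expl; rewrite -expnM (leq_ltn_trans _ (ltn_expl (k * p) card_gt1)) //.
    by rewrite muln_gt0 k0 p_gt0.
  exists (u ^+ (M - n) * w - w').
  rewrite rmorphB rmorphM rmorphXn /= mulrBr -w'E -{2}(subnK nM) exprD.
  have -> : ev u ^+ n = Pi * ev w.
    by rewrite -[ev w](divfK (uX n)) -wE mulrA mulfV // mul1r.
  by ring.
have Ox : O x by apply: BO; rewrite -evxX -evC.
have OuV : O (ev u)^-1 by apply: BO; exists 1, 1%N; rewrite rmorph1 mul1r expr1.
have := Ou O (conj placeO Ox) => /(placeM placeO OuV); rewrite mulKf // => OPiV.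
apply: (place_ideal1 placeO); rewrite -(mulVf P0).
exact: (place_idealMl placeO).
Qed.

Lemma finite_places_ev f : (forall O, finite_place O -> O f) -> exists u, f = ev u.
Proof.
have [u [k [n [k0 ->]]]] := frac_fermat f; have P0 := evx_fermat_neq0 k0.
set Pi := evx _ in P0 *.
elim: n u => [|n IH] u Of; first by exists u; rewrite expr0 divr1.
have [|w wE] := @finite_places_dvd k u k0.
  move=> O [placeO Ox]; rewrite -/Pi.
  rewrite (_ : ev u / Pi = ev u / Pi ^+ n.+1 * Pi ^+ n); last first.
    by rewrite exprS; field; rewrite P0 expf_neq0.
  apply: (placeM placeO); first exact: Of.
  by apply: (placeX placeO); exact: place_evx.
have E : ev u / Pi ^+ n.+1 = ev w / Pi ^+ n.
  by rewrite wE -/Pi exprS; field; rewrite P0 expf_neq0.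
by rewrite E; apply: IH => O /Of; rewrite E.
Qed.

(** * Affine rational points and their places *)

Definition pev (ab : K * K) : {poly {poly K}} -> K :=
  horner_eval ab.2 \o map_poly (horner_eval ab.1).
HB.instance Definition _ ab := GRing.RMorphism.on (pev ab).

Lemma pevC ab f : pev ab f%:P = f.[ab.1].
Proof. by rewrite /pev /= map_polyC /= /horner_eval hornerC. Qed.

Lemma pevX ab : pev ab 'X = ab.2.
Proof. by rewrite /pev /= map_polyX /horner_eval hornerX. Qed.

Lemma pev_G ab : ab \in affine_points p h a -> pev ab G = 0.
Proof.
rewrite inE => /eqP e; rewrite /G !rmorphB /= rmorphXn /= pevX pevC e.
by rewrite hornerZ hornerXn subrr.
Qed.

Lemma pev_ev0 ab u : ab \in affine_points p h a -> ev u = 0 -> pev ab u = 0.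
Proof. by move=> cab /ev_ker [q ->]; rewrite rmorphM /= pev_G // mulr0. Qed.

Definition point_place ab : set F :=
  [set z | exists u s, pev ab s != 0 /\ z = ev u / ev s]%classic.

Lemma place_ideal_pev O ab u : finite_place O ->
    place_ideal O (x - iota ab.1) -> place_ideal O (y - iota ab.2) ->
  place_ideal O (ev u - iota (pev ab u)).
Proof.
case=> placeO Ox mx my; have Oy := place_finite_y placeO Ox.
have mex f : place_ideal O (evx f - iota f.[ab.1]).
  elim/poly_ind: f => [|f c IH].
    by rewrite !rmorph0 horner0 rmorph0 subrr; exact: (place_ideal0 placeO).
  rewrite hornerMXaddC rmorphD rmorphM /= evxC evxX rmorphD rmorphM.
  rewrite (_ : _ - _ =
    x * (evx f - iota f.[ab.1]) + iota f.[ab.1] * (x - iota ab.1)); last by ring.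
  apply: (place_idealD placeO); apply: (place_idealMl placeO) => //.
  exact: (place_iota placeO).
elim/poly_ind: u => [|u f IH].
  by rewrite !rmorph0 subrr; exact: (place_ideal0 placeO).
rewrite !rmorphD !rmorphM /= evX evC pevX pevC.
rewrite (_ : _ - _ = y * (ev u - iota (pev ab u)) + iota (pev ab u) * (y - iota ab.2) +
  (evx f - iota f.[ab.1])); last by ring.
apply: (place_idealD placeO) => //.
apply: (place_idealD placeO); apply: (place_idealMl placeO) => //.
exact: (place_iota placeO).
Qed.

Lemma place_ideal_pevE O ab u : finite_place O ->
    place_ideal O (x - iota ab.1) -> place_ideal O (y - iota ab.2) ->
  place_ideal O (ev u) <-> pev ab u = 0.
Proof.
move=> finO mx my; have mu := place_ideal_pev u finO mx my; case: finO => placeO Ox.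
split=> [mev|u0]; last by move: mu; rewrite u0 rmorph0 subr0.
apply: (place_ideal_iota placeO).
rewrite (_ : iota _ = ev u - (ev u - iota (pev ab u))); last by ring.
exact: (place_idealB placeO).
Qed.

Lemma point_place_uniq O ab : finite_place O ->
    place_ideal O (x - iota ab.1) -> place_ideal O (y - iota ab.2) ->
  O = point_place ab.
Proof.
move=> finO mx my; apply/seteqP; split=> z.
  move=> Oz; have [u [s [ns ->]]] := finite_place_local finO Oz; exists u, s; split=> //.
  by apply/eqP => /(place_ideal_pevE s finO mx my).
case=> u [s [/eqP s0 ->]]; case: (finO) => placeO Ox.
apply: (placeM placeO); first exact: (place_ev _ placeO Ox).
apply: (place_unitV (place_ev _ placeO Ox)).
by move/(place_ideal_pevE s finO mx my).
Qed.

Lemma ev_neq0 ab s : ab \in affine_points p h a -> pev ab s != 0 -> ev s != 0.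
Proof. by move=> cab; apply: contra_neq; apply: pev_ev0. Qed.

(** The local ring [B] of the point is not known to be a valuation ring at this stage. A place above
    [B] with [x - ab.1] in its ideal is taken instead; it also has [y - ab.2] in its ideal, and
    [point_place_uniq] identifies it with [B]. *)
Lemma point_place_spec ab : ab \in affine_points p h a ->
  [/\ finite_place (point_place ab), place_ideal (point_place ab) (x - iota ab.1),
      place_ideal (point_place ab) (y - iota ab.2)
    & rational_places iota (point_place ab)].
Proof.
move=> cab; set B := point_place ab.
have evB u : B (ev u) by exists u, 1; rewrite !rmorph1 oner_neq0 divr1.
have subB : is_subring iota B.
  split=> [c|_ _ [u [s [s0 ->]]] [v [s' [s'0 ->]]]|_ _ [u [s [s0 ->]]] [v [s' [s'0 ->]]]].
  - by rewrite -evxC -evC.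
  - exists (u * s' - v * s), (s * s'); rewrite rmorphM mulf_neq0 //; split=> //.
    have -> : ev (u * s' - v * s) = ev u * ev s' - ev v * ev s by rewrite rmorphB !rmorphM.
    by rewrite rmorphM /=; field; rewrite !(ev_neq0 cab).
  - exists (u * v), (s * s'); rewrite !rmorphM mulf_neq0 //; split=> //.
    by rewrite /=; field; rewrite !(ev_neq0 cab).
have xE : x - iota ab.1 = ev ('X - ab.1%:P)%:P by rewrite evC rmorphB /= evxX evxC.
have Bx : B (x - iota ab.1) by rewrite xE.
have pevx : pev ab ('X - ab.1%:P)%:P = 0 by rewrite pevC hornerXsubC subrr.
have [|O [placeO BO mx]] := place_exists subB Bx.
  case=> u [s [s0 e]]; move/eqP: (s0); apply.
  have es0 : ev s != 0 by exact: ev_neq0 cab s0.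
  have xa0 : x - iota ab.1 != 0.
    rewrite xE evC; apply/eqP => /evx_eq0/eqP; by rewrite polyXsubC_eq0.
  have -> : s = (s - ('X - ab.1%:P)%:P * u) + ('X - ab.1%:P)%:P * u by rewrite subrK.
  rewrite rmorphD rmorphM /= pevx mul0r addr0; apply: (pev_ev0 cab).
  rewrite rmorphB rmorphM /= -xE; apply/eqP; rewrite subr_eq0; apply/eqP.
  by rewrite -[ev u](divfK es0) -e; field.
have Ox : O x by apply: BO; rewrite -evxX -evC.
have finO : finite_place O by split.
have my : place_ideal O (y - iota ab.2).
  (* This is the cofactor of [y - ab.2] in [(y - ab.2)^p - (y - ab.2) = a (x^m - ab.1^m)]. It takes
     the value -1 at the point, hence is a unit of [B]. *)
  pose s : {poly {poly K}} := ('X - ab.2%:P%:P) ^+ p.-1 - 1.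
  have sE : ev s = (y - iota ab.2) ^+ p.-1 - 1.
    by rewrite rmorphB rmorphXn rmorphB rmorph1 /= evX evC evxC.
  have ps : pev ab s != 0.
    rewrite rmorphB rmorphXn rmorphB rmorph1 /= pevX pevC hornerC subrr expr0n.
    by rewrite gtn_eqF ?sub0r ?oppr_eq0 ?oner_eq0 // -ltnS prednK ?p_gt0 // p_gt1.
  have OsV : O (ev s)^-1 by apply: BO; exists 1, s; rewrite rmorph1 mul1r.
  have s0 : ev s != 0 by exact: ev_neq0 cab ps.
  have E : (y - iota ab.2) * ev s = iota a * (x ^+ m - iota ab.1 ^+ m).
    rewrite sE mulrBr mulr1 -exprS prednK ?p_gt0 //.
    rewrite -{1}(expn1 p) (exprBp p_prime pcharF) expn1.
    have := cab; rewrite inE => /eqP/(congr1 iota).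
    rewrite rmorphB rmorphM !rmorphXn /= mulrBr -curve_eq => <-; ring.
  rewrite -(mulfK s0 (y - _)) E; apply: (place_idealMr placeO) => //.
  apply: (place_idealMl placeO); first exact: (place_iota placeO).
  rewrite subrXX mulrC; apply: (place_idealMl placeO) => //.
  apply: (place_sum placeO) => i _; apply: (placeM placeO); apply: (placeX placeO) => //.
  exact: (place_iota placeO).
have OE := point_place_uniq finO mx my; rewrite /B -OE; split=> //; split=> //.
move=> z Oz; have [u [s [ns ->]]] := finite_place_local finO Oz.
have ps : pev ab s != 0 by apply/eqP => /(place_ideal_pevE s finO mx my).
have s0 : ev s != 0 by exact: ev_neq0 cab ps.
exists (pev ab u / pev ab s).
have ips : iota (pev ab s) != 0 by rewrite fmorph_eq0.
rewrite fmorph_div (_ : _ - _ = (iota (pev ab s))^-1 * (ev s)^-1 *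
   (iota (pev ab s) * (ev u - iota (pev ab u)) - iota (pev ab u) * (ev s - iota (pev ab s))));
  last by field; rewrite ips s0.
apply: (place_idealMl placeO).
  apply: (placeM placeO); first by rewrite -fmorphV; exact: (place_iota placeO).
  by apply: (place_unitV (place_ev _ placeO Ox)).
apply: (place_idealB placeO); apply: (place_idealMl placeO);
  by [exact: (place_iota placeO) | exact: place_ideal_pev].
Qed.

Lemma rational_finite_place O : rational_places iota O -> O x ->
  exists2 ab, ab \in affine_points p h a & O = point_place ab.
Proof.
move=> [placeO ratO] Ox; have Oy := place_finite_y placeO Ox.
have finO : finite_place O by split.
have [al mx] := ratO _ Ox; have [be my] := ratO _ Oy.
exists (al, be); last exact: point_place_uniq.
rewrite inE -subr_eq0; apply/eqP.
have := (place_ideal_pevE G finO (mx : place_ideal O (x - iota (al, be).1)) my).1.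
rewrite evG => /(_ (place_ideal0 placeO)).
by rewrite /G !rmorphB /= rmorphXn /= pevX pevC hornerZ hornerXn.
Qed.

Lemma card_setT_ord (T : finType) : ([set: T] #= `I_#|T|)%card.
Proof.
have -> : [set: T]%classic = (enum_val @` [set: 'I_#|T|])%classic.
  by apply/seteqP; split=> // t _; exists (enum_rank t) => //; rewrite enum_rankK.
apply: card_eq_trans (inj_card_eq (in2W enum_val_inj)) _.
by rewrite card_eq_sym; exact: card_II.
Qed.

Lemma card_rational_places : (rational_places iota #= `I_(#|affine_points p h a|.+1))%card.
Proof.
have [Oi infO] := infinite_place_exists.
pose pl (o : option {ab | ab \in affine_points p h a}) :=
  if o is Some ab then point_place (val ab) else Oi.
have pl_inj : injective pl.
  have Some_None ab : point_place (val (ab : {ab | ab \in affine_points p h a})) <> Oi.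
    by move=> e; have [[_ + _ _ _]] := point_place_spec (valP ab); rewrite e; apply: infO.2.
  move=> [ab|] [ab'|] //=; [|by move/Some_None|by move/esym/Some_None].
  move=> e; congr Some; apply: val_inj.
  have [[placeO _] mx my _] := point_place_spec (valP ab).
  have [_ mx' my' _] := point_place_spec (valP ab').
  rewrite -e in mx' my'.
  have same z c c' : place_ideal (point_place (val ab)) (z - iota c) ->
      place_ideal (point_place (val ab)) (z - iota c') -> c = c'.
    move=> h1 h2; apply/eqP; rewrite -subr_eq0; apply/eqP; apply: (place_ideal_iota placeO).
    rewrite rmorphB (_ : _ - _ = (z - iota c') - (z - iota c)); last by ring.
    exact: (place_idealB placeO).
  by apply/pair_eqP/andP; split; apply/eqP; [exact: same mx mx' | exact: same my my'].
have -> : rational_places iota =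
    (pl @` [set: option {ab | ab \in affine_points p h a}])%classic.
  apply/seteqP; split=> O.
    move=> ratO; have [Ox|nx] := pselect (O x).
      by have [ab cab ->] := rational_finite_place ratO Ox; exists (Some (Sub ab cab)).
    by exists None => //; apply: (infinite_place_uniq infO); split=> //; case: ratO.
  case=> [[ab|] _ <-] /=; last exact: infinite_place_rational.
  by have [] := point_place_spec (valP ab).
apply: card_eq_trans (inj_card_eq (in2W pl_inj)) _.
rewrite -(card_sig (mem (affine_points p h a))) -card_option.
exact: card_setT_ord.
Qed.

(** ** Differentials *)

Section PolyDerivation.

Variable b : {poly K}.

Definition partialX (u : {poly {poly K}}) := swapXY (swapXY u)^`().

(* d/dX + b d/dY *)
Definition pderiv (u : {poly {poly K}}) := partialX u + b%:P * u^`().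

Lemma partialXB u v : partialX (u - v) = partialX u - partialX v.
Proof. by rewrite /partialX (raddfB swapXY) derivB (raddfB swapXY). Qed.

Lemma partialXD u v : partialX (u + v) = partialX u + partialX v.
Proof. by rewrite /partialX rmorphD /= derivD rmorphD. Qed.

Lemma pderivB u v : pderiv (u - v) = pderiv u - pderiv v.
Proof.
rewrite /pderiv partialXB derivB.
by move: (partialX u) (partialX v) (u^`()) (v^`()) => u1 v1 u2 v2; ring.
Qed.

Lemma pderivD u v : pderiv (u + v) = pderiv u + pderiv v.
Proof.
rewrite /pderiv partialXD derivD.
by move: (partialX u) (partialX v) (u^`()) (v^`()) => u1 v1 u2 v2; ring.
Qed.

Lemma partialXM u v : partialX (u * v) = partialX u * v + u * partialX v.
Proof. by rewrite /partialX rmorphM /= derivM rmorphD !rmorphM /= !swapXYK. Qed.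

Lemma pderivM u v : pderiv (u * v) = u * pderiv v + v * pderiv u.
Proof.
rewrite /pderiv partialXM derivM.
by move: (partialX u) (partialX v) (u^`()) (v^`()) => u1 v1 u2 v2; ring.
Qed.

Lemma pderivC f : pderiv f%:P = f^`()%:P.
Proof.
by rewrite /pderiv /partialX swapXY_polyC derivC mulr0 addr0 deriv_map swapXY_map_polyC.
Qed.

Lemma pderivX : pderiv 'X = b%:P.
Proof. by rewrite /pderiv /partialX swapXY_X derivX mulr1 derivC rmorph0 add0r. Qed.

Lemma pderivXp : pderiv 'X^p = 0.
Proof.
have charPK : p \in [pchar {poly {poly K}}] by rewrite pchar_poly pchar_polyK.
rewrite /pderiv derivXn (mulrn_pchar charPK) mulr0 addr0 /partialX.
by rewrite rmorphXn /= swapXY_X -rmorphXn /= derivC rmorph0.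
Qed.

End PolyDerivation.

Lemma natr_ph (R : nzRingType) : p \in [pchar R] -> (p ^ h)%:R = 0 :> R.
Proof. by move=> charR; rewrite natrX (pcharf0 charR) expr0n gtn_eqF. Qed.

(* D x = 1 forces D y = - a x^(p^h), by differentiating y^p - y = a x^m. *)
Definition Aderiv := pderiv (- (a *: 'X^(p ^ h))).

Lemma Aderiv_G : Aderiv G = 0.
Proof.
rewrite /Aderiv /G !pderivB pderivXp pderivX pderivC derivZ derivXn /= mulrS.
rewrite -[in _ *+ (p ^ h)]mulr_natr (natr_ph pchar_polyK) mulr0 addr0.
by rewrite sub0r -rmorphN opprK subrr.
Qed.

Lemma ev_Aderiv0 u : ev u = 0 -> ev (Aderiv u) = 0.
Proof.
case/ev_ker => q ->; rewrite /Aderiv pderivM -/Aderiv Aderiv_G mulr0 add0r.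
by rewrite rmorphM /= evG mul0r.
Qed.

Lemma evM u v : ev (u * v) = ev u * ev v. Proof. exact: rmorphM. Qed.
Lemma evD u v : ev (u + v) = ev u + ev v. Proof. exact: rmorphD. Qed.
Lemma evB u v : ev (u - v) = ev u - ev v. Proof. exact: rmorphB. Qed.

Lemma Aderiv1 : Aderiv 1 = 0.
Proof. by rewrite /Aderiv -polyC1 pderivC -polyC1 derivC. Qed.

Lemma ev_AderivM u v :
  ev (Aderiv (u * v)) = ev u * ev (Aderiv v) + ev v * ev (Aderiv u).
Proof. by rewrite /Aderiv pderivM evD !evM. Qed.

Lemma ev_AderivD u v : ev (Aderiv (u + v)) = ev (Aderiv u) + ev (Aderiv v).
Proof. by rewrite /Aderiv pderivD evD. Qed.

Lemma ev_AderivB u v : ev (Aderiv (u - v)) = ev (Aderiv u) - ev (Aderiv v).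
Proof. by rewrite /Aderiv pderivB evB. Qed.

Let dfrac u v := (ev (Aderiv u) * ev v - ev u * ev (Aderiv v)) / ev v ^+ 2.

(** The polynomial [u v' - u' v] vanishes on the curve, and so does its derivative by
    [ev_Aderiv0]. *)
Lemma dfrac_eq u v u' v' : ev v != 0 -> ev v' != 0 ->
  ev u / ev v = ev u' / ev v' -> dfrac u v = dfrac u' v'.
Proof.
move=> v0 v'0 e.
have e0 : ev u * ev v' - ev u' * ev v = 0.
  have -> : ev u = ev u' / ev v' * ev v by rewrite -e divfK.
  by field.
have : ev (Aderiv (u * v' - u' * v)) = 0.
  by apply: ev_Aderiv0; rewrite evB !evM.
rewrite ev_AderivB !ev_AderivM => e1.
apply/eqP; rewrite -subr_eq0 /dfrac; apply/eqP.
have uE : ev u = ev u' * ev v / ev v'.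
  by apply: (mulIf v'0); rewrite divfK //; apply/eqP; rewrite -subr_eq0 e0.
have E : ev (Aderiv u) =
    (ev u' * ev (Aderiv v) + ev v * ev (Aderiv u') - ev u * ev (Aderiv v')) / ev v'.
  apply: (mulIf v'0); rewrite divfK //; apply/eqP; rewrite -subr_eq0 -e1; apply/eqP; ring.
by rewrite E uE; field; rewrite v0 v'0.
Qed.

(** This derivation is [d/dx]. By [der_std] every derivation is a multiple of it, so a regular
    differential is [f dx] with [f] its value there. *)
Lemma std_der_exists : exists D : derivation iota,
  forall u v, ev v != 0 -> D (ev u / ev v) = dfrac u v.
Proof.
pose rel z d := exists u v, [/\ ev v != 0, z = ev u / ev v & d = dfrac u v].
have [D relD] : {D : F -> F & forall z, rel z (D z)}.
  apply: choice => z; have [u [v [v0 ->]]] := fracE z.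
  by exists (dfrac u v), u, v.
have DE u v : ev v != 0 -> D (ev u / ev v) = dfrac u v.
  move=> v0; have [u' [v' [v'0 e ->]]] := relD (ev u / ev v).
  by apply: dfrac_eq.
have DD z w : D (z + w) = D z + D w.
  have [u [v [v0 ->]]] := fracE z; have [u' [v' [v'0 ->]]] := fracE w.
  have -> : ev u / ev v + ev u' / ev v' = ev (u * v' + u' * v) / ev (v * v').
    by rewrite evD !evM; field; rewrite v0 v'0.
  have vv' : ev (v * v') != 0 by rewrite rmorphM mulf_neq0.
  rewrite !DE // /dfrac ev_AderivD !ev_AderivM evD !evM.
  by field; rewrite v0 v'0.
have DM z w : D (z * w) = z * D w + w * D z.
  have [u [v [v0 ->]]] := fracE z; have [u' [v' [v'0 ->]]] := fracE w.
  have -> : ev u / ev v * (ev u' / ev v') = ev (u * u') / ev (v * v').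
    by rewrite !evM; field; rewrite v0 v'0.
  have vv' : ev (v * v') != 0 by rewrite rmorphM mulf_neq0.
  rewrite !DE // /dfrac !ev_AderivM !evM.
  by field; rewrite v0 v'0.
have Dc c : D (iota c) = 0.
  have -> : iota c = ev c%:P%:P / ev 1 by rewrite evC evxC rmorph1 divr1.
  rewrite DE ?rmorph1 ?oner_neq0 // /dfrac Aderiv1 /Aderiv pderivC derivC.
  by rewrite !rmorph0 mul0r mulr0 subr0 mul0r.
by exists (Defs.Derivation DD DM Dc).
Qed.

Definition std_der := projT1 (cid std_der_exists).

Lemma std_derE u v : ev v != 0 -> std_der (ev u / ev v) = dfrac u v.
Proof. exact: (projT2 (cid std_der_exists)). Qed.

Lemma std_der_ev u : std_der (ev u) = ev (Aderiv u).
Proof.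
have := @std_derE u 1; rewrite rmorph1 divr1 => -> //; last exact: oner_neq0.
by rewrite /dfrac Aderiv1 rmorph0 mulr0 subr0 rmorph1 mulr1 expr1n divr1.
Qed.

Lemma std_der_x : std_der x = 1.
Proof.
rewrite -evxX -evC std_der_ev /Aderiv pderivC derivX evC.
exact: rmorph1.
Qed.

Section Derivation.

Variable D : derivation iota.

Lemma derD u v : D (u + v) = D u + D v. Proof. by case: D. Qed.
Lemma derM u v : D (u * v) = u * D v + v * D u. Proof. by case: D. Qed.
Lemma der_iota c : D (iota c) = 0. Proof. by case: D. Qed.

Lemma der0 : D 0 = 0.
Proof. by rewrite -{1}(rmorph0 iota) der_iota. Qed.

Lemma der_sum (I : Type) (s : seq I) (f : I -> F) :
  D (\sum_(i <- s) f i) = \sum_(i <- s) D (f i).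
Proof. by apply: (big_morph D derD der0). Qed.

Lemma der_iotaM c z : D (iota c * z) = iota c * D z.
Proof. by rewrite derM der_iota mulr0 addr0. Qed.

Lemma derX z n : D (z ^+ n) = n%:R * z ^+ n.-1 * D z.
Proof.
elim: n => [|n IH]; first by rewrite expr0 -(rmorph1 iota) der_iota !mul0r.
rewrite exprS derM IH -natr1; case: n {IH} => [|n] /=.
  by rewrite expr0; ring.
by rewrite exprS; ring.
Qed.

Lemma derV z : z != 0 -> D z^-1 = - D z / z ^+ 2.
Proof.
move=> z0; have := derM z z^-1; rewrite mulfV // -(rmorph1 iota) der_iota => e.
apply: (mulfI z0); apply/eqP; rewrite -subr_eq0; apply/eqP.
rewrite (_ : _ - _ = z * D z^-1 + z^-1 * D z) //; by field.
Qed.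

Lemma der_y : D y = - (iota a * x ^+ (p ^ h)) * D x.
Proof.
have /(congr1 D) := curve_eq; rewrite -[y ^+ p](subrK y) addrK.
have := derD (y ^+ p - y) y; rewrite subrK derX (pcharf0 pcharF) !mul0r => /esym/eqP.
rewrite addr_eq0 => /eqP ->.
rewrite der_iotaM derX -natr1 (natr_ph pcharF) add0r mul1r /= => e.
by rewrite -[D y]opprK e; ring.
Qed.

Lemma der_ev u : D (ev u) = ev (Aderiv u) * D x.
Proof.
have der_ex f : D (evx f) = evx f^`() * D x.
  elim/poly_ind: f => [|f c IH]; first by rewrite deriv0 !rmorph0 mul0r der0.
  rewrite derivMXaddC !rmorphD !rmorphM /= evxX evxC derD derM der_iota IH; ring.
elim/poly_ind: u => [|u f IH].
  rewrite /Aderiv -[0]/(0%:P%:P) pderivC derivC.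
  by rewrite evC rmorph0 der0 mul0r.
rewrite ev_AderivD ev_AderivM evD evM /Aderiv pderivX pderivC -/Aderiv evX !evC.
have -> : evx (- (a *: 'X^(p ^ h))) = - (iota a * x ^+ (p ^ h)).
  by rewrite -evx_monomial rmorphN.
by rewrite derD derM IH der_ex der_y; ring.
Qed.

Lemma der_std z : D z = std_der z * D x.
Proof.
have [u [v [v0 ->]]] := fracE z; rewrite std_derE // derM derV // !der_ev /dfrac.
by field.
Qed.

End Derivation.

(** [O] is a localization of [K[x, y]], which [d/dx] maps to itself. *)
Lemma std_der_finite O z : finite_place O -> O z -> O (std_der z).
Proof.
move=> finO Oz; have [u [s [ns ->]]] := finite_place_local finO Oz.
case: finO => placeO Ox; have Oev w : O (ev w) by exact: (place_ev _ placeO Ox).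
have OsV := place_unitV (Oev s) ns.
have s0 : ev s != 0.
  by apply/eqP => s0; apply: ns; rewrite s0; exact: (place_ideal0 placeO).
rewrite std_derE // /dfrac -exprVn; apply: (placeM placeO); last exact: (placeX placeO).
by apply: (placeB placeO); apply: (placeM placeO).
Qed.

(** * Orders of derivatives at infinity *)

Lemma leads_tinfX n : leads (tinf ^ n) 1 n.
Proof.
split; first exact: oner_neq0.
move=> O [placeO _]; rewrite rmorph1 mul1r divff ?tinf_expz_neq0 // subrr.
exact: (place_ideal0 placeO).
Qed.

Lemma leads_iotaM e z c k : e != 0 -> leads z c k -> leads (iota e * z) (e * c) k.
Proof. by move=> e0 lz; rewrite -[k]add0r; apply: leadsM => //; apply: leads_iota. Qed.

Lemma leadsD z w c d k l : leads z c k -> leads w d l -> k < l -> leads (z + w) c k.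
Proof.
move=> lz lw kl; split; first exact: lz.1.
move=> O infO; rewrite mulrDl addrAC; apply: (place_idealD infO.1); first exact: lz.2.
have lr := leadsM lw (leadsV (leads_iotaM lz.1 (leads_tinfX k))).
by apply: leads_ideal_pos lr infO _; rewrite subr_gt0.
Qed.

(* 2g - 1, where g is the genus *)
Local Notation T := (p * p ^ h - m)%N.

Definition order_ge (O : set F) (n : int) z := O (z * tinf ^ (- n)).

Section OrderGe.

Variable O : set F.
Hypothesis infO : infinite_place O.

Let placeO := infO.1.

Lemma order_ge0 n : order_ge O n 0.
Proof. by rewrite /order_ge mul0r; exact: (place0 placeO). Qed.

Lemma order_geD n z w : order_ge O n z -> order_ge O n w -> order_ge O n (z + w).
Proof. by rewrite /order_ge mulrDl; apply: (placeD placeO). Qed.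

Lemma order_geN n z : order_ge O n z -> order_ge O n (- z).
Proof. by rewrite /order_ge mulNr; apply: (placeN placeO). Qed.

Lemma order_ge_sum n (I : Type) (s : seq I) (P : pred I) (f : I -> F) :
  (forall i, P i -> order_ge O n (f i)) -> order_ge O n (\sum_(i <- s | P i) f i).
Proof.
by move=> fO; apply: big_ind => //; [exact: order_ge0 | exact: order_geD].
Qed.

Lemma order_geM n l z w : order_ge O n z -> order_ge O l w -> order_ge O (n + l) (z * w).
Proof.
rewrite /order_ge opprD expfzDr ?tinf_neq0 // mulrACA; exact: (placeM placeO).
Qed.

Lemma order_ge_leads n z c k : leads z c k -> order_ge O n z <-> n <= k.
Proof.
move=> lz; have lz' := leadsM lz (leads_tinfX (- n)).
by rewrite -subr_ge0; apply: leads_place lz' infO.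
Qed.

Lemma order_ge_mono n n' z : n <= n' -> order_ge O n' z -> order_ge O n z.
Proof.
move=> nn'; have [->|z0] := eqVneq z 0; first by move=> _; exact: order_ge0.
have [c [k lz]] := leads_exists z0.
by move/(order_ge_leads _ lz) => ?; apply/(order_ge_leads _ lz); apply: le_trans nn' _.
Qed.

Lemma order_ge_mon n c i j : (n <= - (i * p + j * m)%N%:Z) ->
  order_ge O n (iota c * (x ^+ i * y ^+ j)).
Proof.
move=> nw; have [->|c0] := eqVneq c 0; first by rewrite rmorph0 mul0r; exact: order_ge0.
by have [d _ ld] := leads_mon i j; apply/(order_ge_leads _ (leads_iotaM c0 ld)).
Qed.

Lemma ph_gt1 : (1 < p ^ h)%N.
Proof. by rewrite -(expn0 p) ltn_exp2l // p_gt1. Qed.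

Lemma T_add : (T + m = p * p ^ h)%N.
Proof. by rewrite subnK //; have := p_gt1; have := ph_gt1; nia. Qed.

(** Up to constants, [d/dx] either trades a factor [y] for [x^(p^h)], which raises the weight by
    [p p^h - m = T], or removes a factor [x]. *)
Lemma order_ge_der_mon i j :
  order_ge O (- (i * p + j * m)%N%:Z - T%:Z) (std_der (x ^+ i * y ^+ j)).
Proof.
have TE := T_add; have h2 := ph_gt1.
rewrite derM !derX der_y std_der_x !mulr1; apply: order_geD.
  case: j => [|j]; first by rewrite !mul0r mulr0; exact: order_ge0.
  rewrite (_ : _ * _ = iota (- (j.+1%:R * a)) * (x ^+ (i + p ^ h) * y ^+ j)).
    by apply: order_ge_mon; nia.
  by rewrite rmorphN rmorphM rmorph_nat exprD /=; ring.
case: i => [|i]; first by rewrite !mul0r mulr0; exact: order_ge0.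
rewrite (_ : _ * _ = iota i.+1%:R * (x ^+ i * y ^+ j)).
  by apply: order_ge_mon; nia.
by rewrite rmorph_nat /=; ring.
Qed.

(** The order of a reduced [u] is the least order of its monomials, so the bound on monomials
    carries over without cancellation issues. *)
Lemma order_ge_der_ev u c k : leads (ev u) c k -> order_ge O (k - T%:Z) (std_der (ev u)).
Proof.
have [_ [v [sv _ ->]]] := ev_reduce u; move=> lv.
have v0 : v != 0 by apply: contraNneq (leads_neq0 lv) => ->; rewrite rmorph0.
have [i [j [d [_ lv' maxij]]]] := leads_ev sv v0.
rewrite (leads_uniq lv lv') (ev_sum sv (leqnn _)) der_sum.
apply: order_ge_sum => -[i' j'] _ /=.
have [->|/maxij le] := eqVneq v`_j'`_i' 0.
  by rewrite rmorph0 mul0r der0; exact: order_ge0.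
rewrite der_iotaM -[X in order_ge O X](add0r); apply: order_geM.
  rewrite -[iota _]mulr1 -[1](expr0 x) -[x ^+ 0]mulr1 -[1 in X in order_ge _ _ X](expr0 y).
  exact: order_ge_mon.
by apply: order_ge_mono (order_ge_der_mon i' j'); rewrite lerD2r lerN2 lez_nat.
Qed.

Lemma order_ge_der z c k : leads z c k -> order_ge O (k - T%:Z) (std_der z).
Proof.
have [u [v [v0 ->]]] := fracE z; move=> lz; have z0 := leads_neq0 lz.
have u0 : ev u != 0 by apply: contraNneq z0 => ->; rewrite mul0r.
have [d [l lv]] := leads_exists v0.
have lu : leads (ev u) (c * d) (k + l).
  by rewrite -[ev u](divfK v0); apply: leadsM.
have lV := leadsV lv.
rewrite derM derV // [X in order_ge _ _ X]addrC; apply: order_geD => //.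
  rewrite [X in order_ge _ _ X]mulrC (_ : k - T%:Z = (k + l - T%:Z) + (- l)); last by ring.
  by apply: order_geM; [exact: order_ge_der_ev lu | apply/(order_ge_leads _ lV)].
have -> : ev u * (- std_der (ev v) / ev v ^+ 2) =
    - (ev u / ev v * (std_der (ev v) * (ev v)^-1)) by field.
apply: order_geN; rewrite (_ : k - T%:Z = k + ((l - T%:Z) + (- l))); last by ring.
apply: order_geM; first by apply/(order_ge_leads _ lz).
by apply: order_geM; [exact: order_ge_der_ev lv | apply/(order_ge_leads _ lV)].
Qed.

(** Subtracting the residue of [z] leaves the derivative unchanged and raises the order to at least
    1. The resulting bound [1 - T] is attained at [tinf]. *)
Lemma order_ge_der_place z : O z -> order_ge O (1 - T%:Z) (std_der z).
Proof.
have pos w : place_ideal O w -> order_ge O (1 - T%:Z) (std_der w).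
  have [->|w0] := eqVneq w 0; first by rewrite der0 => _; exact: order_ge0.
  have [c [k lw]] := leads_exists w0; move/(leads_ideal lw infO) => k0.
  by apply: order_ge_mono (order_ge_der lw); rewrite lerD2r.
move=> Oz; have [_ /(_ z Oz) [c mc]] := infinite_place_rational infO.
by rewrite -(subrK (iota c) z) derD der_iota addr0; apply: pos.
Qed.

End OrderGe.

(** * Regular differentials and the genus *)

Lemma regular_at_std_der O (eta : derivation iota -> F) D :
  regular_at O eta -> eta D = eta std_der * D x.
Proof.
case=> s [_ etaE]; rewrite !etaE mulr_suml; apply: eq_bigr => fu _.
by rewrite der_std mulrA.
Qed.

Lemma regular_at_finite O (eta : derivation iota -> F) :
  finite_place O -> regular_at O eta -> O (eta std_der).
Proof.
move=> finO [s [sO ->]]; have [placeO _] := finO.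
rewrite big_seq; apply: (place_sum placeO) => fu /sO [O1 O2].
by apply: (placeM placeO) => //; apply: std_der_finite.
Qed.

Lemma regular_at_infinite O (eta : derivation iota -> F) :
  infinite_place O -> regular_at O eta -> order_ge O (1 - T%:Z) (eta std_der).
Proof.
move=> infO [s [sO ->]]; have [placeO _] := infO.
rewrite big_seq; apply: (order_ge_sum infO) => fu /sO [O1 O2].
rewrite -[X in order_ge _ X]add0r; apply: (order_geM infO); last exact: order_ge_der_place.
by rewrite /order_ge oppr0 expr0z mulr1.
Qed.

Lemma leads_std_der_tinf : exists c, leads (std_der tinf) c (1 - T%:Z).
Proof.
have TE := T_add; have hE := expnh; have h2 := ph_gt1; have p2 := p_gt1.
set q := (p ^ h.-1)%N in hE; have q0 : (0 < q)%N by rewrite expn_gt0 p_gt0.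
have y0 := y_neq0.
have -> : std_der tinf = iota a * (x ^+ (q + p ^ h) * (y ^+ 2)^-1) +
    iota q%:R * (x ^+ q.-1 * y^-1).
  rewrite /tinf -/q derM derV // derX der_y std_der_x rmorph_nat exprD; field.
  by rewrite y0.
have [c1 _ l1] := leads_mon (q + p ^ h) 0.
have [c2 _ l2] := leads_mon 0 2.
have := leads_iotaM a_neq0 (leadsM l1 (leadsV l2)).
rewrite !expr0 mulr1 mul1r.
rewrite (_ : _ + - _ = 1 - T%:Z) => [l12|]; last by nia.
(* The first term of [dt/dx] has order [1 - T]. The second, if its coefficient is non-zero, has
   order [p + 1] and is dominated. *)
have [q0'|qn0] := eqVneq (q%:R : K) 0.
  by rewrite q0' rmorph0 mul0r addr0; eexists; exact: l12.
have [c3 _ l3] := leads_mon q.-1 0; have [c4 _ l4] := leads_mon 0 1.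
have := leads_iotaM qn0 (leadsM l3 (leadsV l4)).
rewrite !expr0 expr1 mulr1 mul1r => l34.
by eexists; apply: leadsD l12 l34 _; nia.
Qed.

Lemma regular_monomial i j : (i * p + j * m < T)%N ->
  regular_differential (fun D : derivation iota => x ^+ i * y ^+ j * D x).
Proof.
move=> wT O placeO; have [Ox|nx] := pselect (O x).
  exists [:: (x ^+ i * y ^+ j, x)]; split; last by move=> D; rewrite big_seq1.
  move=> fu; rewrite inE => /eqP -> /=; split=> //.
  by apply: (placeM placeO); apply: (placeX placeO) => //; exact: (place_finite_y placeO Ox).
have infO : infinite_place O by split.
have [c lt] := leads_std_der_tinf; have dt0 := leads_neq0 lt.
(* At infinity [x] is not in [O], so [dx] is rewritten as [dt / (dt/dx)]; the coefficient then has
   order [T - 1 - (i p + j m)]. *)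
exists [:: (x ^+ i * y ^+ j / std_der tinf, tinf)]; split; last first.
  by move=> D; rewrite big_seq1 /= (der_std D tinf) mulrA divfK.
move=> fu; rewrite inE => /eqP -> /=; split; last exact: (place_ideal_sub (tinf_ideal infO)).
have [d _ ld] := leads_mon i j.
by apply/(leads_place (leadsM ld (leadsV lt)) infO); lia.
Qed.

(** Hence the finite index range of [genus_index] omits no monomial of weight below [T]. *)
Lemma weight_lt i j : (i * p + j * m < T)%N -> (i < p ^ h)%N && (j < p.-1)%N.
Proof. by have := T_add; have := ph_gt1; have := p_gt1 => *; apply/andP; split; nia. Qed.

Lemma sizeY_leq (u : {poly {poly K}}) n :
  (forall i j, u`_j`_i != 0 -> (i < n)%N) -> (sizeY u <= n)%N.
Proof.
move=> un; rewrite /sizeY; apply/bigmax_leqP => j _; apply/leq_sizeP => i ni.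
by apply/eqP; apply: contraLR ni; rewrite -ltnNge; apply: un.
Qed.

(** Regularity at the finite places puts [f] in [K[x, y]]. At infinity the order of [f] is at least
    [1 - T], and since it is the order of the heaviest monomial, each monomial has weight below
    [T]. *)
Lemma regular_differential_ev (eta : derivation iota -> F) :
  regular_differential eta -> exists u, [/\ eta std_der = ev u, (size u <= p.-1)%N,
    (sizeY u <= p ^ h)%N & forall i j, u`_j`_i != 0 -> (i * p + j * m < T)%N].
Proof.
move=> reg; have [O infO] := infinite_place_exists.
have [u0 u0E] : exists u, eta std_der = ev u.
  by apply: finite_places_ev => O' finO'; exact: (regular_at_finite finO' (reg O' finO'.1)).
have [_ [u [su _ uE]]] := ev_reduce u0; exists u; rewrite u0E uE.
have wT i j : u`_j`_i != 0 -> (i * p + j * m < T)%N.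
  move=> uij; have u_neq0 : u != 0.
    by apply: contraNneq uij => ->; rewrite !coef0.
  have [i0 [j0 [c [_ lu maxij]]]] := leads_ev su u_neq0.
  have := regular_at_infinite infO (reg O infO.1); rewrite u0E uE.
  move/(order_ge_leads infO _ lu) => T_le; apply: leq_ltn_trans (maxij _ _ uij) _; lia.
split=> //; last first.
  by apply: sizeY_leq => i j /wT/weight_lt/andP[].
apply/leq_sizeP => j pj; apply/polyP => i; rewrite coef0; apply/eqP.
by apply: contraLR pj; rewrite -ltnNge => /wT/weight_lt/andP[].
Qed.

Lemma evxZ c f : evx (c *: f) = iota c * evx f.
Proof. by rewrite -mul_polyC rmorphM /= evxC. Qed.

Lemma evZ f u : ev (f *: u) = evx f * ev u.
Proof. by rewrite -mul_polyC rmorphM /= evC. Qed.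

Lemma curve_genus : has_genus iota #|genus_index p h|.
Proof.
pose mon (ij : 'I_(p ^ h) * 'I_p.-1) := x ^+ ij.1 * y ^+ ij.2.
pose e (k : 'I_#|genus_index p h|) : 'I_(p ^ h) * 'I_p.-1 := enum_val k.
exists (fun k D => mon (e k) * D x); split.
  by move=> k; have := enum_valP k; rewrite inE -/(e k); exact: regular_monomial.
have [O infO] := infinite_place_exists.
move=> eta reg; have [u [uE su sYu wT]] := regular_differential_ev reg.
have etaE : eta std_der = \sum_(k < #|genus_index p h|)
    iota u`_(e k).2`_(e k).1 * mon (e k).
  rewrite uE (ev_sum su sYu) (bigID (mem (genus_index p h))) /= [X in _ + X]big1 ?addr0.
    by rewrite big_enum_val.
  move=> ij; rewrite inE => nij; have [->|/wT] := eqVneq u`_ij.2`_ij.1 0.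
    by rewrite rmorph0 mul0r.
  by rewrite (negPf nij).
exists [ffun k : 'I_#|genus_index p h| => u`_(e k).2`_(e k).1]; split.
  move=> D; rewrite (regular_at_std_der D (reg O infO.1)) etaE mulr_suml.
  by apply: eq_bigr => k _; rewrite ffunE mulrA.
move=> c /(_ std_der); rewrite etaE => cE; apply/ffunP => k0; rewrite ffunE.
pose d (k : 'I_#|genus_index p h|) := u`_(e k).2`_(e k).1 - c k.
(* The difference of two coordinate families, read as a polynomial of degree below [p] in the outer
   variable: it vanishes on the curve, so it is zero by [ev_inj]. *)
pose v : {poly {poly K}} :=
  \sum_(k < #|genus_index p h|) ((d k *: 'X^((e k).1)) *: 'X^((e k).2)).
have coefv i j : v`_j`_i =
    \sum_(k < #|genus_index p h|) d k * (i == (e k).1)%:R * (j == (e k).2)%:R.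
  rewrite !coef_sum; apply: eq_bigr => k _.
  by rewrite coefZ coefXn [in LHS]mulr_natr coefMn coefZ coefXn [RHS]mulr_natr.
have v0 : v = 0.
  apply: ev_inj.
    apply/leq_sizeP => l pl; apply/polyP => i; rewrite coef0 coefv big1 // => k _.
    by rewrite [l == _]gtn_eqF ?mulr0 // (leq_trans (ltn_ord _) (leq_trans (leq_pred p) pl)).
  rewrite rmorph_sum /= -[RHS](subrr (eta std_der)) {1}etaE etaE [X in _ - X]cE -sumrB.
  apply: eq_bigr => k _; rewrite std_der_x mulr1.
  rewrite evZ evxZ !rmorphXn /= evxX evX /d rmorphB /mon; ring.

have := coefv (e k0).1 (e k0).2; rewrite v0 !coef0.
rewrite (bigD1 k0) //= !eqxx !mulr1 big1 ?addr0.
  by move/esym/eqP; rewrite subr_eq0 => /eqP.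
move=> k /negPf kk0; rewrite -mulrA -natrM mulnb.
rewrite (_ : _ && _ = false) ?mulr0 //; apply/negP => /andP[e1 e2].
move: kk0; rewrite -(inj_eq enum_val_inj) -pair_eqE /= /pair_eq /=.
rewrite [_.1 == _]eq_sym [X in _ && X]eq_sym.
by rewrite -!val_eqE e1 e2.
Qed.

End Curve.

(** * The additive polynomial and the two curves *)

Lemma E_poly_monomial p h (K : fieldType) (a : K) : prime p ->
  E_poly p h (a *: 'X^(p ^ h)) = a ^+ (p ^ h) *: 'X^(p ^ (2 * h)) + a *: 'X.
Proof.
move=> p_pr; rewrite /E_poly exprZn -exprM -expnD addnn mul2n; congr (_ + _).
rewrite big_ord_recr /= subnn expn0 expr1 coefZ coefXn eqxx mulr1 big1 ?add0r // => i _.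
rewrite coefZ coefXn eqn_exp2l ?prime_gt1 // (ltn_eqF (ltn_ord i)) mulr0 scale0r.
by rewrite expr0n gtn_eqF // expn_gt0 prime_gt0.
Qed.

Lemma splittingFieldFor_fullv (F0 : fieldType) (L : fieldExtType F0) (U : {subfield L})
    (E : {poly L}) (rs : seq L) :
  E %= \prod_(z <- rs) ('X - z%:P) -> (forall z, z \in <<U & rs>>%VS) ->
  splittingFieldFor U E fullv.
Proof.
move=> Ers genL; exists rs => //; apply/eqP; rewrite eqEsubv subvf; apply/subvP => z _.
exact: genL.
Qed.

Lemma splitting_field_maximal p h (K : finFieldType) (charK : p \in [pchar K])
    (R : {poly K}) (c : K) :
    #|K| = (p ^ (2 * h))%N -> c != 0 ->
  splitting_field_of charK R (c *: ('X^(p ^ (2 * h)) - 'X)).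
Proof.
move=> cardK c0 U _; rewrite -cardK.
have [rs _ Ers] := dvdp_genPoly (dvdpp ('X^#|K| - 'X : {poly K})).
have Ers' : c *: ('X^#|K| - 'X) %= \prod_(z <- rs) ('X - z%:P).
  by apply: eqp_trans Ers; rewrite eqp_scale.
apply: (@splittingFieldFor_fullv _ _ _ _ (rs : seq (pPrimeCharType charK))) => // z.
apply: seqv_sub_adjoin; have := root_prod_XsubC rs (z : K).
rewrite -(eqp_root Ers) /root !hornerE => <-.
by rewrite (@expf_card K) subrr.
Qed.

(** As [p] is odd, each [z] is half the sum of [z - z^Q], a root of [E], and of [z + z^Q], an
    element of [F_Q]. *)
Lemma splitting_field_minimal p h (K : finFieldType) (charK : p \in [pchar K])
    (R : {poly K}) : prime p -> odd p -> (0 < h)%N ->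
    #|K| = (p ^ (4 * h))%N ->
  splitting_field_of charK R ('X^(p ^ (2 * h)) + 'X).
Proof.
move=> p_pr p_odd h0 cardK U _.
set Q := (p ^ (2 * h))%N; set E : {poly K} := 'X^Q + 'X.
have QQ : (Q * Q = #|K|)%N by rewrite cardK -expnD; congr (_ ^ _)%N; lia.
have Q_gt1 : (1 < Q)%N by rewrite -(expn0 p) ltn_exp2l ?prime_gt1 // muln_gt0.
have charPK : p \in [pchar {poly K}] by rewrite pchar_poly.
have E_dvd : E %| 'X^#|K| - 'X.
  have -> : 'X^#|K| - 'X = E ^+ Q - E.
    by rewrite /E (exprDp p_pr charPK) -exprM QQ; ring.
  by rewrite dvdp_sub // dvdp_expr_self // ltnW.
have [rs _ Ers] := dvdp_genPoly E_dvd.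
have memrs z : (z \in rs) = (z ^+ Q + z == 0).
  by rewrite -root_prod_XsubC -(eqp_root Ers) /root !hornerE.
have [b b0 brs] : exists2 b : K, b != 0 & b \in rs.
  have : (0 < #|([set z | root E z] :\ (0 : K))%R|)%N.
    have := cardsD1 (0 : K) [set z | root E z].
    rewrite card_roots_dvdp // /E size_polyDl ?size_polyXn ?size_polyX //=; lia.
  case/card_gt0P => b; rewrite !inE => /andP[b0 Eb]; exists b => //.
  by rewrite memrs; move: Eb; rewrite /root !hornerE.
have two0 : (2%:R : K) != 0.
  rewrite -(dvdn_pcharf charK); apply: contraL p_odd => p_dvd2.
  have /eqP -> : p == 2; last by [].
  by rewrite eqn_leq (dvdn_leq _ p_dvd2) // prime_gt1.
apply: (@splittingFieldFor_fullv _ _ _ _ (rs : seq (pPrimeCharType charK))) => // z.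
pose L : {subfield pPrimeCharType charK} := <<U & (rs : seq (pPrimeCharType charK))>>%AS.
change (z \in L).
have Lrs w : w \in rs -> w \in L by move=> wrs; apply: seqv_sub_adjoin.
have zQQ : (z : K) ^+ Q ^+ Q = z by rewrite -exprM QQ (@expf_card K).
have Lsub : (z : K) - z ^+ Q \in L.
  by apply: Lrs; rewrite memrs (exprBp p_pr charK) zQQ; apply/eqP; ring.
(* b F_Q is the set of roots of E, so that quotients of roots generate F_Q. *)
have Ladd : (z : K) + z ^+ Q \in L.
  rewrite -[X in X \in _](@mulfK K b b0); apply: rpred_div; apply: Lrs => //.
  move: brs; rewrite !memrs exprMn (exprDp p_pr charK) zQQ => /eqP e.
  apply/eqP; rewrite (_ : _ + _ = (z + z ^+ Q) * (b ^+ Q + b)); last by ring.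
  by rewrite e mulr0.
have -> : z = ((z : K) + z ^+ Q + (z - z ^+ Q)) / 2%:R :> K by field.
by apply: rpred_div; [exact: rpredD | exact: rpred_nat].
Qed.

Lemma sqrtC_natX2 n : sqrtC (n * n)%:R = n%:R :> algC.
Proof. by rewrite natrM -expr2 sqrCK // ler0n. Qed.

Lemma minimal_CR_monomial p h (K : finFieldType) : prime p -> p \in [pchar K] ->
  (0 < h)%N -> #|K| = (p ^ (4 * h))%N -> minimal_CR p ('X^(p ^ h) : {poly K}).
Proof.
move=> p_pr charK h0 cardK F iota x y.
rewrite -[X in is_function_field_CR _ _ X]scale1r => curve.
have one0 := oner_neq0 K.
exists #|affine_points p h (1 : K)|.+1, #|genus_index p h|; split.
- exact: (card_rational_places p_pr charK h0 cardK one0 curve).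
- exact: (curve_genus p_pr charK h0 cardK one0 curve).
have gE := card_genus_index p_pr h0.
rewrite (card_affine_points_min p_pr h0 charK cardK).
have Q2 : (p ^ (2 * h) = p ^ h * p ^ h)%N by rewrite -expnD addnn mul2n.
have KE : (p ^ (4 * h) = p ^ (2 * h) * p ^ (2 * h))%N by rewrite -expnD; congr (_ ^ _)%N; lia.
have hE : (p ^ h = p * p ^ h.-1)%N by rewrite -expnS prednK.
have q0 : (0 < p ^ h.-1)%N by rewrite expn_gt0 prime_gt0.
rewrite cardK KE sqrtC_natX2.
set g := #|_| in gE *.
(* The subtracted term of the minimality equation is moved to the left, so that the identity can be
   proved in the natural numbers. *)
have N_eq : ((p ^ (2 * h) * (1 + (p ^ h).+1 * (p ^ h.-1 - 1)) * p).+1 + 2 * p ^ (2 * h) * g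
    = p ^ (2 * h) * p ^ (2 * h) + 1)%N.
  rewrite (mulnAC 2) (mulnC 2) gE Q2.
  move: hE q0 (prime_gt0 p_pr); move: (p ^ h)%N (p ^ h.-1)%N => P [//|q] -> _.
  by case: (p) => // k _; rewrite subn1 /=; clear; lia.
move: N_eq => /(congr1 (fun n => n%:R : algC)); rewrite !natrD => <-.
by rewrite !natrM addrK.
Qed.

Lemma maximal_CR_monomial p h (K : finFieldType) (a : K) : prime p -> p \in [pchar K] ->
    (0 < h)%N -> #|K| = (p ^ (2 * h))%N -> a != 0 -> a ^+ (p ^ h) = - a ->
  maximal_CR p (a *: 'X^(p ^ h)).
Proof.
move=> p_pr charK h0 cardK a0 aP F iota x y curve.
exists #|affine_points p h a|.+1, #|genus_index p h|; split.
- exact: (card_rational_places p_pr charK h0 cardK a0 curve).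
- exact: (curve_genus p_pr charK h0 cardK a0 curve).
have gE := card_genus_index p_pr h0.
rewrite (card_affine_points_max p_pr charK cardK aP).
have Q2 : (p ^ (2 * h) = p ^ h * p ^ h)%N by rewrite -expnD addnn mul2n.
rewrite cardK Q2 sqrtC_natX2.
set g := #|_| in gE *.
have N_eq : ((p ^ h * p ^ h * p).+1 = p ^ h * p ^ h + 1 + 2 * p ^ h * g)%N.
  by move: gE (prime_gt0 p_pr); move: (p ^ h)%N => P; case: (p) => // k gE _; nia.
by rewrite N_eq !natrD !natrM.
Qed.

Theorem proposition9p3 (p h : nat) (p_prime : prime p) (p_odd : odd p)
    (h_ge1 : (1 <= h)%N) :
  (forall (K : finFieldType) (charK : p \in [pchar K]),
     #|K| = (p ^ (4 * h))%N ->
     let R : {poly K} := 'X^(p ^ h) in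
     [/\ E_poly p h R = 'X^(p ^ (2 * h)) + 'X,
         splitting_field_of charK R (E_poly p h R)
       & minimal_CR p R])
  /\
  (forall (K : finFieldType) (charK : p \in [pchar K]),
     #|K| = (p ^ (2 * h))%N ->
     forall a : K, a != 0 -> a ^+ (p ^ h - 1) = -1 ->
     let R : {poly K} := a *: 'X^(p ^ h) in
     [/\ E_poly p h R = a ^+ (p ^ h) *: ('X^(p ^ (2 * h)) - 'X),
         splitting_field_of charK R (E_poly p h R)
       & maximal_CR p R]).
Proof.
split=> K charK cardK => [|a a0 aP].
  rewrite /= -[X in E_poly _ _ X]scale1r E_poly_monomial // expr1n !scale1r; split=> //.
    exact: splitting_field_minimal.
  exact: minimal_CR_monomial.
have aPN : a ^+ (p ^ h) = - a.
  rewrite -(@subnK 1 (p ^ h)) ?expn_gt0 ?prime_gt0 //.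
  by rewrite addn1 exprSr aP mulN1r.
have E_a : E_poly p h (a *: 'X^(p ^ h)) = a ^+ (p ^ h) *: ('X^(p ^ (2 * h)) - 'X).
  by rewrite E_poly_monomial // aPN scalerBr !scaleNr opprK.
rewrite /= E_a; split=> //; last exact: maximal_CR_monomial.
by apply: splitting_field_maximal => //; rewrite aPN oppr_eq0.
Qed.
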